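(* Let $\beta=(\beta_j)_{j\ge 0}$ be a sequence of nonnegative real numbers, with $\beta(t)=\sum_{j\ge 0}\beta_j t^j$ and $\beta'(t)=\sum_{j\ge1}j\beta_jt^{j-1}$. Set $z^*=\inf\{t\in[0,1):\beta'(t)+\log(1-t)<0\}\wedge 1$ and let $\zeta$ be the set of zeros of $\beta'(t)+\log(1-t)$ in $[0,z^* )$. Assume that $z^*<1$ and $\zeta=\varnothing$. For each $N\in\mathbb{N}$, let $V^N$ be a set of $N$ vertices and let $\Lambda^N$ be a Poisson$(\beta)$ random hypergraph on $V^N$. Let $V^{N*}$ be the set of identifiable vertices of $\Lambda^N$ and $\Lambda^{N*}$ its identifiable hypergraph. Then, as $N\to\infty$, the following limits hold in probability: $$\frac{|V^{N*}|}{N}\to z^*,\qquad \frac{|\Lambda^{N*}|}{N}\to \beta(z^* )-(1-z^* )\log(1-z^* ).$$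
   Context: A hypergraph on a finite set $V$ is a map $\Lambda:\mathcal{P}(V)\to\mathbb{Z}^+=\{0,1,2,\dots\}$ ($\Lambda(A)$ is the number of hyperedges on $A\subseteq V$; hyperedges on $\varnothing$ are allowed). The total number of hyperedges is $|\Lambda|=\sum_{A\subseteq V}\Lambda(A)$. Identifiability: a vertex $v$ is identifiable in $1$ step if $\Lambda(\{v\})\ge1$; for $n\ge2$, $v$ is identifiable in $n$ steps if it belongs to some $A\subseteq V$ with $\Lambda(A)\ge1$ all of whose other elements are identifiable in fewer than $n$ steps. A vertex is identifiable if it is identifiable in $n$ steps for some $n\ge1$. $V^*$ denotes the set of identifiable vertices, and the identifiable hypergraph is $\Lambda^*(A)=\Lambda(A)\mathbb{1}_{\{A\subseteq V^*\}}$, so $|\Lambda^*|=\sum_{A\subseteq V^*}\Lambda(A)$. A random hypergraph $\Lambda$ on $V$ with $|V|=N$ is Poisson$(\beta)$ if the random variables $\Lambda(A)$, $A\subseteq V$, are independent and, whenever $|A|=j$, $\Lambda(A)$ is Poisson with mean $N\beta_j/\binom{N}{j}$ (for $j=0,1,\dots,N$). The power series $\beta(t),\beta'(t)$ take values in $[0,\infty]$ for $t\ge0$, and $\inf\varnothing=+\infty$. *)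

(* Defs.v *)
From HB Require Import structures.
From mathcomp Require Import all_boot all_order all_algebra.
From mathcomp Require Import all_classical all_reals all_analysis.

Set Implicit Arguments.
Unset Strict Implicit.
Unset Printing Implicit Defensive.

Import Order.TTheory GRing.Theory Num.Theory.
Import numFieldNormedType.Exports.

Local Open Scope classical_set_scope.
Local Open Scope ring_scope.

Definition hypergraph (V : finType) := {set V} -> nat.

Definition total_edges (V : finType) (L : hypergraph V) : nat :=
  (\sum_(A : {set V}) L A)%N.

Inductive identifiable_in (V : finType) (L : hypergraph V) : nat -> V -> Prop :=
| identifiable_in1 v : (1 <= L [set v]%SET)%N -> identifiable_in L 1 v
| identifiable_inS n v (A : {set V}) :
    (2 <= n)%N -> v \in A -> (1 <= L A)%N ->
    (forall w, w \in A -> w != v ->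
       exists2 m, (m < n)%N & identifiable_in L m w) ->
    identifiable_in L n v.

Definition identifiable (V : finType) (L : hypergraph V) (v : V) : Prop :=
  exists2 n, (1 <= n)%N & identifiable_in L n v.

Definition identifiable_set (V : finType) (L : hypergraph V) : {set V} :=
  [set v | `[< identifiable L v >]]%SET.

Definition identifiable_hypergraph (V : finType) (L : hypergraph V) :
    hypergraph V :=
  fun A => if A \subset identifiable_set L then L A else 0%N.

Definition mutually_independent d d' (T : measurableType d)
    (T' : measurableType d') (R : realType) (P : probability T R) (I : finType)
    (X : I -> {RV P >-> T'}) : Prop :=
  forall (J : {set I}) (B : I -> set T'),
    (forall i, i \in J -> measurable (B i)) ->
    P (\bigcap_(i in [set` J]) (X i @^-1` B i)) =
    (\prod_(i in J) P (X i @^-1` B i))%E.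

(* The second argument of [poisson_prob] is a dummy: [poisson_prob r 0] is the
   Poisson law of mean [r], and the Dirac mass at 0 when [r = 0]. *)
Definition poisson_hypergraph d (T : measurableType d) (R : realType)
    (P : probability T R) (beta : nat -> R) (V : finType)
    (L : {set V} -> {RV P >-> nat}) : Prop :=
  mutually_independent L /\
  forall (A : {set V}) (U : set nat),
    distribution P (L A) U =
    poisson_prob (#|V|%:R * beta #|A| / 'C(#|V|, #|A|)%:R) 0 U.

Definition hypergraph_at d (T : measurableType d) (R : realType)
    (P : probability T R) (V : finType) (L : {set V} -> {RV P >-> nat})
    (w : T) : hypergraph V :=
  fun A => L A w.

Definition power_sum (R : realType) (beta : nat -> R) (t : R) : \bar R :=
  (\sum_(0 <= j <oo) (beta j * t ^+ j)%:E)%E.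

Definition power_sum' (R : realType) (beta : nat -> R) (t : R) : \bar R :=
  (\sum_(1 <= j <oo) (j%:R * beta j * t ^+ j.-1)%:E)%E.

Definition drift (R : realType) (beta : nat -> R) (t : R) : \bar R :=
  (power_sum' beta t + (ln (1 - t))%:E)%E.

(* [ereal_inf set0 = +oo], and the minimum with 1 lies in [0, 1], so [fine] only
   changes the type. *)
Definition zstar (R : realType) (beta : nat -> R) : R :=
  fine (Order.min
    (ereal_inf [set t%:E | t in [set t : R | 0 <= t < 1 /\ (drift beta t < 0)%E]])
    1%:E).

Definition zeta (R : realType) (beta : nat -> R) : set R :=
  [set t | 0 <= t < zstar beta /\ drift beta t = 0%E].

(* The random variables may live on different probability spaces. *)
Definition cvg_in_prob (R : realType) (d : nat -> measure_display)
    (T : forall N, measurableType (d N)) (P : forall N, probability (T N) R)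
    (X : forall N, T N -> R) (c : R) : Prop :=
  forall e : R, 0 < e ->
    (fun N => P N [set w | e < `|X N w - c|]) @ \oo --> 0%E.

(* Main.v *)
(* Write V* for the set of identifiable vertices, N = |V| and z for the limit.
   For S a set of k vertices, "V* = S" means that the edges inside S identify all
   of S and that no edge A has |A \ S| = 1. These two events are independent, and
   the second one has probability exp(-(N - k) r_k), where r_k is the total rate
   of the edges A with A \ S = {v}, for a fixed v outside S. Summing over S,
     sum_(S <= U) gen(S) exp(-|U \ S| r_|S|) = 1   for every U <= V,
   which determines gen. Sellke's construction satisfies the same recursion: give
   the vertices i.i.d. exponential thresholds and stop at the first k such that at
   most k thresholds are below r_k. So V* has the law of Sellke's final set, and
   since r_k is close to beta'(k/N), Chernoff bounds for binomial variables give
   |V*|/N -> z.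
   For the edges, multiplying all Poisson rates by x = exp(theta) tilts the law:
     E[x^|L*|; V* = S] = exp((x - 1) G_k) P_x(V* = S),   k = |S|,
   where L* is the identifiable hypergraph and G_k the mean number of edges A with
   |A \ S| <= 1. Hence |L*| concentrates exponentially around G_|V*|, and
   G_|V*|/N -> beta(z) + (1 - z) beta'(z) = beta(z) - (1 - z) log(1 - z). *)

Require Import Defs.
From HB Require Import structures.
From mathcomp Require Import all_boot all_order all_algebra.
From mathcomp Require Import all_classical all_reals all_analysis.
From mathcomp Require Import ring lra.

Set Implicit Arguments.
Unset Strict Implicit.
Unset Printing Implicit Defensive.

Import Order.TTheory GRing.Theory Num.Theory.
Import numFieldNormedType.Exports.

Local Open Scope classical_set_scope.
Local Open Scope ring_scope.

(** * Finite product weights *)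

Section FiniteProduct.
Variables (R : realType) (I X : finType).
Implicit Types (w : I -> X -> R) (f g : {ffun I -> X}).
Implicit Types (D : {set I}) (E : {ffun I -> X} -> bool).

(** The total mass is not fixed to be 1: truncated and tilted Poisson weights are measured in the
    same way as probabilities. *)
Definition wprob w E : R := \sum_(f | E f) \prod_i w i (f i).

Definition depends_on D E := forall f g, {in D, f =1 g} -> E f = E g.

Definition normalized w := forall i, \sum_x w i x = 1.

Definition mix D f g : {ffun I -> X} := [ffun i => if i \in D then f i else g i].

Lemma wprob_family w (Q : I -> pred X) :
  wprob w (fun f => [forall i, Q i (f i)]) = \prod_i \sum_(x | Q i x) w i x.
Proof.
by rewrite bigA_distr_big_dep; apply: eq_bigl => f; apply/forallP/familyP.
Qed.

Lemma wprob_total w : normalized w -> wprob w predT = 1.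
Proof.
move=> w1; transitivity (wprob w (fun f => [forall i, predT (f i)])).
  by apply: eq_bigl => f; apply/esym/forallP.
by rewrite (wprob_family w (fun=> predT)) big1.
Qed.

Lemma eq_wprob w E1 E2 : E1 =1 E2 -> wprob w E1 = wprob w E2.
Proof. by move=> E12; apply: eq_bigl. Qed.

Lemma wprob_ge0 w E : (forall i x, 0 <= w i x) -> 0 <= wprob w E.
Proof. by move=> w0; apply: sumr_ge0 => f _; apply: prodr_ge0. Qed.

Lemma wprob_le w E1 E2 : (forall i x, 0 <= w i x) ->
  (forall f, E1 f -> E2 f) -> wprob w E1 <= wprob w E2.
Proof.
move=> w0 E12; rewrite /wprob big_mkcond [leRHS]big_mkcond /=.
apply: ler_sum => f _; case: ifPn => [/E12-> //|_].
by case: ifP => // _; apply: prodr_ge0.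
Qed.

Lemma sum_wprob (J : finType) w E (G : J -> {ffun I -> X} -> bool) (Q : pred J) :
  (forall f, E f = [exists j, Q j && G j f]) ->
  (forall f j k, G j f -> G k f -> j = k) ->
  wprob w E = \sum_(j | Q j) wprob w (G j).
Proof.
move=> EG uG; rewrite /wprob.
rewrite (exchange_big_dep E) /=; last first.
  by move=> j f Qj Gj; rewrite EG; apply/existsP; exists j; rewrite Qj.
apply: eq_bigr => f; rewrite EG => /existsP[j /andP[Qj Gj]].
rewrite [RHS](bigD1 j) ?Qj //= [X in _ + X]big1 ?addr0 // => k /andP[/andP[_ Gk]].
by rewrite (uG _ _ _ Gk Gj) eqxx.
Qed.

(* Two independent copies may exchange their coordinates outside [D]; both
   independence and locality of events follow from this. *)
Lemma sum_mix D (F : {ffun I -> X} -> {ffun I -> X} -> R) :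
  \sum_f \sum_g F f g = \sum_f \sum_g F (mix D f g) (mix D g f).
Proof.
rewrite !pair_bigA /=.
pose h (p : {ffun I -> X} * {ffun I -> X}) := (mix D p.1 p.2, mix D p.2 p.1).
have hK : involutive h.
  by case=> f g; congr (_, _); apply/ffunP => i; rewrite !ffunE /=; case: ifP; rewrite ?ffunE => ->.
by rewrite [LHS](reindex_inj (inv_inj hK)).
Qed.

Lemma wprob_prod w w' E1 E2 :
  wprob w E1 * wprob w' E2 =
  \sum_f \sum_g (E1 f && E2 g)%:R * \prod_i (w i (f i) * w' i (g i)).
Proof.
rewrite /wprob big_mkcond mulr_suml; apply: eq_bigr => f _.
rewrite [in LHS](big_mkcond (fun g => E2 g)) mulr_sumr; apply: eq_bigr => g _.
by rewrite big_split /=; case: (E1 f); case: (E2 g); rewrite /= ?(mul0r, mulr0, mul1r).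
Qed.

Lemma wprob_indep w D E1 E2 : normalized w -> depends_on D E1 ->
  depends_on (~: D) E2 ->
  wprob w (fun f => E1 f && E2 f) = wprob w E1 * wprob w E2.
Proof.
move=> w1 dE1 dE2; rewrite -[LHS]mulr1 -(wprob_total w1) !wprob_prod.
rewrite [RHS](sum_mix D).
apply: eq_bigr => f _; apply: eq_bigr => g _; rewrite andbT; congr (_%:R * _).
  congr (_ && _); first by apply: dE1 => i iD; rewrite ffunE iD.
  by apply: dE2 => i; rewrite inE ffunE => /negPf->.
by apply: eq_bigr => i _; rewrite !ffunE; case: ifP => // _; rewrite mulrC.
Qed.

(** One copy carries [w] and the other [w']; exchanging their coordinates outside [D] keeps the
    event and swaps the roles of the two laws. *)
Lemma eq_wprob_on w w' D E : normalized w -> normalized w' ->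
  depends_on D E -> (forall i, i \in D -> w i =1 w' i) ->
  wprob w E = wprob w' E.
Proof.
move=> w1 w'1 dE ww'; rewrite -[LHS]mulr1 -[RHS]mulr1.
rewrite -{1}(wprob_total w'1) -{1}(wprob_total w1) !wprob_prod.
rewrite [RHS](sum_mix D).
apply: eq_bigr => f _; apply: eq_bigr => g _; rewrite !andbT; congr ((nat_of_bool _)%:R * _).
  by apply: dE => i iD; rewrite ffunE iD.
apply: eq_bigr => i _; rewrite !ffunE; case: ifP => [iD|_].
  by rewrite !ww'.
by rewrite mulrC.
Qed.

Lemma wprob_indep_forall w D E (Q : I -> pred X) : normalized w ->
  depends_on (~: D) E ->
  wprob w (fun f => E f && [forall i in D, Q i (f i)]) =
  wprob w E * \prod_(i in D) \sum_(x | Q i x) w i x.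
Proof.
move=> w1 dE; rewrite (wprob_indep w1 dE); last first.
  rewrite finset.setCK => f g fg; apply: eq_forallb => i.
  by case: (boolP (i \in D)) => //= /fg->.
congr (_ * _).
apply: etrans (wprob_family w (fun i x => (i \in D) ==> Q i x)) _.
rewrite [RHS]big_mkcond /=; apply: eq_bigr => i _.
by case: (i \in D) => //=; apply: w1.
Qed.

End FiniteProduct.

(** * Closure under hyperedges *)

Section Closure.
Variable V : finType.
Implicit Types (h : hypergraph V) (S U : {set V}) (b : {ffun {set V} -> bool}).

(** For A = {v} the inclusion holds trivially, so singletons and larger edges obey one rule. The
    identifiable set is the least closed set, which replaces step counts from here on. *)
Definition closed_under h S := forall (A : {set V}) v,
  v \in A -> (0 < h A)%N -> (A :\ v)%SET \subset S -> v \in S.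

Lemma identifiable_set_closed h : closed_under h (identifiable_set h).
Proof.
move=> A v vA hA /fintype.subsetP sA.
have /choice[f fP] : forall w, exists n, w \in (A :\ v)%SET -> identifiable_in h n w.
  move=> w; case: (boolP (w \in (A :\ v)%SET)) => [/sA|]; last by exists 0%N.
  by rewrite inE => /asboolP[n _ hn]; exists n.
(* The number of steps must exceed every [f w] and be at least 2. *)
rewrite inE; apply/asboolP; exists (\max_w f w).+2 => //.
apply: (identifiable_inS (A := A)) => // w wA wv; exists (f w).
  by rewrite ltnS ltnW // ltnS leq_bigmax.
by apply: fP; rewrite !inE wv.
Qed.

Lemma identifiable_set_min h S : closed_under h S -> identifiable_set h \subset S.
Proof.
move=> clS; apply/fintype.subsetP => v; rewrite inE => /asboolP[n _].
elim/ltn_ind: n v => n IH v hv; inversion hv as [u hu|k u A k2 uA hA wA]; subst.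
  by apply: (clS [set v]%SET) => //; rewrite ?set11 // finset.setDv finset.sub0set.
apply: (clS A) => //; apply/fintype.subsetP => w /setD1P[wv {}/wA].
by case=> // m mn /IH; apply.
Qed.

(** Identification depends on which edges are present and not on their multiplicities, so boolean
    configurations suffice. *)
Definition restrict b U : hypergraph V := fun A => b A && (A \subset U).

Definition cl b U := identifiable_set (restrict b U).

Lemma cl_sub b U : cl b U \subset U.
Proof.
apply: identifiable_set_min => A v vA; rewrite lt0b => /andP[_ /fintype.subsetP AU] _.
exact: AU.
Qed.

(** The two conditions on the right concern disjoint families of edges; this is the source of
    independence. *)
Lemma cl_eqE b S U : S \subset U -> (cl b U == S) =
  (cl b S == S) &&
  [forall A in [set A : {set V} | (A \subset U) && (#|A :\: S| == 1%N)]%SET, ~~ b A].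
Proof.
move=> SU; have cU := @identifiable_set_closed (restrict b U).
have cS := @identifiable_set_closed (restrict b S).
apply/eqP/andP => [clU|[/eqP clS /forall_inP nob]].
  rewrite -/(cl b U) clU in cU; split; last first.
    apply/forall_inP => A; rewrite inE => /andP[AU /cards1P[v Av]].
    apply/negP => bA; have /setDP[vA /negP[]] : v \in (A :\: S)%SET by rewrite Av set11.
    apply: (cU A) => //; first by rewrite lt0b bA.
    apply/fintype.subsetP => w; rewrite !inE => /andP[wv wA]; apply: contraTT wv => wS.
    by rewrite negbK; apply/eqP/set1P; rewrite -Av inE wS.
  (* [cl b S] is closed for the edges within [U]: a vertex identified from [cl b S] lies in
     [cl b U = S], so its edge lies inside [S]. *)
  rewrite finset.eqEsubset cl_sub /= -{1}clU; apply: identifiable_set_min.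
  move=> A v vA; rewrite lt0b => /andP[bA AU] AvT.
  have vS : v \in S.
    apply: (cU A) => //; first by rewrite lt0b bA.
    exact: fintype.subset_trans AvT (cl_sub _ _).
  apply: (cS A) => //; rewrite lt0b bA /= -(finset.setD1K vA) finset.subUset finset.sub1set vS.
  exact: fintype.subset_trans AvT (cl_sub _ _).
(* Without edges leaving [S] by exactly one vertex, [S] is closed for the edges within [U]. *)
apply/eqP; rewrite finset.eqEsubset; apply/andP; split.
  apply: identifiable_set_min => A v vA; rewrite lt0b => /andP[bA AU] AvS.
  apply/negPn/negP => vS; move: bA; apply/negP; apply: nob.
  rewrite inE AU /=; apply/cards1P; exists v; apply/setP => w; rewrite !inE.
  case: (eqVneq w v) => [->|wv]; first by rewrite vA vS.
  case: (boolP (w \in A)) => wA; rewrite ?andbF //= andbT; apply/negbTE/negPn.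
  by apply: (fintype.subsetP AvS); rewrite !inE wv.
rewrite -{1}clS; apply: identifiable_set_min => A v vA.
rewrite lt0b => /andP[bA AS]; apply: cU => //.
by rewrite lt0b bA (fintype.subset_trans AS SU).
Qed.

Lemma eq_identifiable_set h1 h2 : (forall A, (0 < h1 A)%N = (0 < h2 A)%N) ->
  identifiable_set h1 = identifiable_set h2.
Proof.
move=> e; apply/eqP; rewrite finset.eqEsubset.
by apply/andP; split; apply: identifiable_set_min => A v vA hA AS;
  apply: (identifiable_set_closed vA) => //; move: hA; rewrite e.
Qed.

End Closure.

(** * The recursion for the law of the final set *)

Section FinalSet.
Variables (R : realType) (V : finType).
Implicit Types (S U : {set V}) (b : {ffun {set V} -> bool}).

(** The law of the indicator that a Poisson variable of mean [l A] is positive. *)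
Definition edge_weight (l : {set V} -> R) (A : {set V}) (x : bool) : R :=
  if x then 1 - expR (- l A) else expR (- l A).

Lemma normalized_edge_weight l : normalized (edge_weight l).
Proof. by move=> A; rewrite big_bool /= subrK. Qed.

Definition gen l S := wprob (edge_weight l) (fun b => cl b S == S).

Lemma depends_on_cl U : depends_on [set A : {set V} | A \subset U]%SET (fun b => cl b U == U).
Proof.
move=> f g fg; congr (_ == _); apply: eq_identifiable_set => A; rewrite !lt0b.
by case: (boolP (A \subset U)) => AU; rewrite ?andbF// !andbT fg// inE.
Qed.

Lemma depends_onW (I X : finType) (D D' : {set I}) (E : {ffun I -> X} -> bool) :
  D \subset D' -> depends_on D E -> depends_on D' E.
Proof. by move=> /fintype.subsetP DD' dE f g fg; apply: dE => i /DD'/fg. Qed.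

Lemma wprob_cl l S U : S \subset U ->
  wprob (edge_weight l) (fun b => cl b U == S) =
  gen l S * \prod_(A : {set V} | (A \subset U) && (#|A :\: S| == 1%N)) expR (- l A).
Proof.
move=> SU; rewrite (eq_wprob _ (fun b => cl_eqE b SU)).
rewrite (wprob_indep_forall (fun A x => ~~ x) (@normalized_edge_weight l)); last first.
  apply: depends_onW (@depends_on_cl S); apply/fintype.subsetP => A; rewrite !inE => AS.
  by rewrite finset.setDE disjoint_setI0 ?cards0 ?andbF// -finset.setI_eq0 -finset.setDE finset.setD_eq0.
congr (_ * _); apply: eq_big => [A|A _]; first by rewrite inE.
by rewrite big_mkcond big_bool /= add0r.
Qed.

Lemma sum_subsets (F : nat -> R) S :
  \sum_(A : {set V} | A \subset S) F #|A| =
  \sum_(i < #|S|.+1) 'C(#|S|, i)%:R * F i.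
Proof.
rewrite (partition_big (fun A : {set V} => inord #|A| : 'I_#|S|.+1) predT) //=.
apply: eq_bigr => i _; rewrite -cards_draws.
rewrite (eq_big (fun A : {set V} => A \in [set A : {set V} | A \subset S & #|A| == i]%SET) (fun=> F i)).
- by rewrite sumr_const mulr_natl.
- move=> A; rewrite inE; case: (boolP (A \subset S)) => //= AS.
  by rewrite -val_eqE /= inordK // ltnS subset_leq_card.
- by move=> A /andP[AS /eqP<-]; rewrite inordK // ltnS subset_leq_card.
Qed.

(** This is r_k: for [S] of size [k] and [v] outside, the edges A with A \ S = {v} arise by adding
    [v] to a subset of [S]. *)
Definition rate (l : nat -> R) k := \sum_(i < k.+1) 'C(k, i)%:R * l i.+1.

(** Double counting: each edge is charged to its only vertex outside [S], and every vertex of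
    [U :\: S] collects the same rate. *)
Lemma sum_boundary l S U : S \subset U ->
  \sum_(A : {set V} | (A \subset U) && (#|A :\: S| == 1%N)) l #|A| =
  #|U :\: S|%:R * rate l #|S|.
Proof.
move=> SU.
transitivity (\sum_(A : {set V} | (A \subset U) && (#|A :\: S| == 1%N))
   \sum_(v in U :\: S | A :\: S == [set v]%SET) l #|A|).
  apply: eq_bigr => A /andP[AU /cards1P[v Av]].
  rewrite (big_pred1 v) // => w; rewrite Av (inj_eq finset.set1_inj) /= [v == w]eq_sym.
  case: eqVneq => [->|]; rewrite ?andbF//= andbT.
  have : v \in (A :\: S)%SET by rewrite Av set11.
  by rewrite !inE => /andP[-> /(fintype.subsetP AU)->].
rewrite (exchange_big_dep (fun v => v \in U :\: S)%SET) //=; last by move=> A v _ /andP[].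
rewrite (eq_bigr (fun=> rate l #|S|)) ?sumr_const ?mulr_natl// => v /setDP[vU vS].
rewrite /rate -(sum_subsets (fun k => l k.+1)).
(* Deleting [v] maps these edges bijectively to the subsets of [S]. *)
rewrite (reindex_onto (fun A => v |: A)%SET (fun A => A :\ v)%SET) /=; last first.
  move=> A; rewrite !inE => /and3P[_ _ /eqP Av]; rewrite finset.setD1K //.
  by have : v \in (A :\: S)%SET; [rewrite Av set11 | rewrite inE => /andP[]].
apply: eq_big => [A|A].
  apply/idP/idP => [/andP[/and3P[_ _ /eqP e] /eqP <-]|AS].
    apply/fintype.subsetP => w; rewrite !inE => /andP[wv wA]; apply: contraTT wv => wS.
    by rewrite negbK; apply/eqP/set1P; rewrite -e !inE wS.
  have vA : v \notin A by apply: contra vS; exact: (fintype.subsetP AS).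
  rewrite finset.setU1K // eqxx andbT !inE vU vS /=.
  have -> : ((v |: A) :\: S = [set v])%SET.
    apply/setP => w; rewrite !inE; case: (eqVneq w v) => [->|wv] /=; first by rewrite vS.
    by case: (boolP (w \in A)) => [/(fintype.subsetP AS)->|]; rewrite ?andbF.
  by rewrite cards1 !eqxx !andbT finset.subUset finset.sub1set vU (fintype.subset_trans AS SU).
move=> /andP[_ /eqP e]; rewrite cardsU1.
have -> : v \notin A by rewrite -e !inE eqxx.
by [].
Qed.

Lemma wprob_cl_card (l : nat -> R) S U : S \subset U ->
  wprob (edge_weight (fun A => l #|A|)) (fun b => cl b U == S) =
  gen (fun A => l #|A|) S * expR (- rate l #|S|) ^+ #|U :\: S|.
Proof.
move=> SU; rewrite wprob_cl //; congr (_ * _).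
rewrite -expR_sum sumrN sum_boundary // -expRM_natl; congr expR.
by rewrite mulrN.
Qed.

Lemma sum_gen (l : nat -> R) U :
  \sum_(S : {set V} | S \subset U)
    gen (fun A => l #|A|) S * expR (- rate l #|S|) ^+ #|U :\: S| = 1.
Proof.
rewrite -[RHS](wprob_total (normalized_edge_weight (fun A => l #|A|))).
under eq_bigr => S SU do rewrite -wprob_cl_card //.
apply/esym/(@sum_wprob R _ _ {set V} _ predT (fun S b => cl b U == S)
  (fun S => S \subset U)).
  by move=> b; apply/esym/existsP; exists (cl b U); rewrite cl_sub eqxx.
by move=> b S S' /eqP<- /eqP.
Qed.

(** The term S = U has coefficient 1, so the value at [U] is determined by the values at proper
    subsets. *)
Lemma recursion_uniq (q1 q2 c : {set V} -> R) :
  (forall U, \sum_(S : {set V} | S \subset U) q1 S * c S ^+ #|U :\: S| = 1) ->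
  (forall U, \sum_(S : {set V} | S \subset U) q2 S * c S ^+ #|U :\: S| = 1) ->
  q1 =1 q2.
Proof.
move=> h1 h2 U; have [n] := ubnP #|U|; elim: n U => // n IH U Un.
have := h1 U; rewrite -(h2 U) (bigD1 U) //= [in RHS](bigD1 U) //=.
rewrite finset.setDv cards0 !mulr1 => e; move: e.
rewrite (eq_bigr (fun S : {set V} => q2 S * c S ^+ #|U :\: S|)); first by move/addIr.
move=> S /andP[SU SneU]; rewrite IH //.
by apply: (@leq_trans #|U|) => //; apply: proper_card; rewrite finset.properEneq SneU.
Qed.

End FinalSet.

(** * Sellke's construction *)

Section Sellke.
Variables (R : realType) (V : finType) (r : nat -> R).
Hypotheses (r_ge0 : forall k, 0 <= r k) (r_mono : {homo r : i j / (i <= j)%N >-> i <= j}).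
Implicit Types (S U : {set V}) (f : {ffun V -> 'I_#|V|.+2}).

(* An exponential threshold is recorded only through its level, the first [k]
   with threshold at most [r k], or the last level [n] if it exceeds [r n.-1];
   [survival n j] is the probability of a level at least [j]. *)
Definition survival (n j : nat) : R :=
  if j == 0%N then 1 else if (j <= n)%N then expR (- r j.-1) else 0.

Definition level_weight (v : V) (x : 'I_#|V|.+2) : R :=
  survival #|V|.+1 x - survival #|V|.+1 x.+1.

Lemma level_weight_ge0 v x : 0 <= level_weight v x.
Proof.
rewrite subr_ge0 /survival /=; case: ltnP => xn; last by case: ifP => // _; case: ifP.
rewrite (ltnW xn); case: (val x) => [|m] /=; first by rewrite expR_le1 oppr_le0.
by rewrite ler_expR lerN2 r_mono.
Qed.

Lemma sum_tail (T : nat -> R) m k : (k < m)%N ->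
  \sum_(x < m | (k < x)%N) (T x - T x.+1) = T k.+1 - T m.
Proof.
elim: m => // m IH; rewrite ltnS leq_eqVlt => /predU1P[->|km].
  by rewrite big1 ?subrr // => x; rewrite ltnNge -ltnS ltn_ord.
by rewrite big_mkcond big_ord_recr /= km -big_mkcond IH // addrA subrK.
Qed.

Lemma level_weight_tail v (k : nat) : (k <= #|V|)%N ->
  \sum_(x : 'I_#|V|.+2 | (k < x)%N) level_weight v x = expR (- r k).
Proof.
move=> kV; rewrite (sum_tail (survival #|V|.+1)); last by rewrite ltnS ltnW.
by rewrite /survival /= ltnS kV ltnn subr0.
Qed.

Lemma normalized_level_weight : normalized level_weight.
Proof.
move=> v; rewrite (bigID (fun x : 'I_#|V|.+2 => (0 < x)%N)) /= level_weight_tail //.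
have -> : \sum_(x : 'I_#|V|.+2 | ~~ (0 < x)%N) level_weight v x = level_weight v ord0.
  by apply: big_pred1 => x; rewrite /= -val_eqE /= lt0n negbK.
by rewrite /level_weight /survival /= addrC subrK.
Qed.

(** In terms of thresholds, more than [i] of those in [S] are at most [r i] for every i < |S|: the
    process run inside [S] does not stop before it has taken all of [S]. *)
Definition filling S f :=
  [forall i : 'I_#|S|, (i < #|[set v in S | (f v <= i)%N]%SET|)%N].

Definition final S U f :=
  filling S f && [forall v in (U :\: S)%SET, (#|S| < f v)%N].

Lemma wprob_final S U : S \subset U ->
  wprob level_weight (final S U) =
  wprob level_weight (filling S) * expR (- r #|S|) ^+ #|U :\: S|.
Proof.
move=> SU; rewrite (wprob_indep_forall (fun _ (x : 'I__) => (#|S| < x)%N) normalized_level_weight).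
  rewrite (eq_bigr (fun=> expR (- r #|S|))) ?prodr_const// => v _.
  by rewrite level_weight_tail // max_card.
move=> f g fg; apply: eq_forallb => i; congr (_ < _)%N; apply: eq_card => v; rewrite !inE.
by case: (boolP (v \in S)) => //= vS; rewrite fg // !inE vS.
Qed.

(** Let [S] be the smaller set. Every vertex of [U] of level at most [#|S|] is in [S]; were [S']
    larger, filling at [#|S|] would produce too many of them. *)
Lemma final_uniq U S S' f : S \subset U -> S' \subset U ->
  final S U f -> final S' U f -> S = S'.
Proof.
wlog le : S S' / (#|S| <= #|S'|)%N.
  move=> H SU S'U fS fS'; case: (leqP #|S| #|S'|) => [|/ltnW] le; first exact: H.
  by apply/esym/H.
move=> SU S'U /andP[fS /forall_inP uS] /andP[/forallP fS' /forall_inP uS'].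
have sub v : v \in U -> (f v <= #|S|)%N -> v \in S.
  move=> vU; apply: contraTT => vS; rewrite -ltnNge uS // inE vS vU.
  by [].
have eqc : #|S| = #|S'|.
  apply/eqP; rewrite eqn_leq le leqNgt; apply/negP => lt.
  have /= := fS' (Ordinal lt); rewrite ltnNge => /negP[]; apply: subset_leq_card.
  by apply/fintype.subsetP => v; rewrite inE => /andP[/(fintype.subsetP S'U) /sub h /h].
apply/esym/eqP; rewrite eqEcard eqc leqnn andbT; apply/fintype.subsetP => v vS'.
have S0 : (#|S'|.-1 < #|S'|)%N by rewrite prednK // card_gt0; apply/set0Pn; exists v.
(* At the last index, filling forces every vertex of [S'] to have level at most [#|S'|.-1]. *)
have /= cS' := fS' (Ordinal S0).
have eS : [set w in S' | (f w <= #|S'|.-1)%N]%SET = S'.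
  apply/eqP; rewrite eqEcard; apply/andP; split.
    by apply/fintype.subsetP => w; rewrite inE => /andP[].
  by move: cS'; rewrite prednK // (leq_ltn_trans _ S0).
apply: sub; first exact: (fintype.subsetP S'U).
move: vS'; rewrite -eS inE eqc => /andP[_ h]; exact: leq_trans h (leq_pred _).
Qed.

(** The process stops at the first [k] for which at most [k] vertices have level at most [k]; these
    vertices form the final set. *)
Lemma final_exists U f : exists2 S : {set V}, S \subset U & final S U f.
Proof.
pose F k := [set v in U | (f v <= k)%N]%SET.
have FU k : F k \subset U by apply/fintype.subsetP => v; rewrite inE => /andP[].
have exk : exists k, (#|F k| <= k)%N by exists #|U|; exact: subset_leq_card.
case: (ex_minnP exk) => k Fk kmin.
have Fi i : (i < k)%N -> (i < #|F i|)%N.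
  by move=> ik; rewrite ltnNge; apply/negP => /kmin; rewrite leqNgt ik.
have cFk : #|F k| = k.
  (* For positive [k], minimality gives more than [k.-1] vertices of level at most [k.-1], hence
     exactly [k] of level at most [k]. *)
  apply/eqP; rewrite eqn_leq Fk /=; case: k Fi {kmin Fk} => // k /(_ k (ltnSn _)).
  move=> h; apply: leq_trans h _; apply: subset_leq_card.
  by apply/fintype.subsetP => v; rewrite !inE => /andP[-> /leqW].
exists (F k) => //; apply/andP; split.
  apply/forallP => -[i]; rewrite cFk /= => ik.
  apply: leq_trans (Fi _ ik) _; apply: subset_leq_card.
  apply/fintype.subsetP => v; rewrite !inE => /andP[-> fi]; rewrite fi andbT /=.
  exact: leq_trans fi (ltnW ik).
by apply/forall_inP => v; rewrite !inE cFk; case: (v \in U); rewrite //= andbT -ltnNge.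
Qed.

Lemma sum_final_le (Q : pred {set V}) (E : {ffun V -> 'I_#|V|.+2} -> bool) :
  (forall S f, Q S -> final S [set: V]%SET f -> E f) ->
  \sum_(S : {set V} | Q S) wprob level_weight (final S [set: V]%SET) <=
  wprob level_weight E.
Proof.
move=> QE; rewrite -(@sum_wprob R _ _ {set V} level_weight
  (fun f => [exists S, Q S && final S [set: V]%SET f]) (fun S => final S [set: V]%SET) Q) //.
  apply: wprob_le; first exact: level_weight_ge0.
  by move=> f /existsP[S /andP[QS]]; exact: QE.
by move=> f S S'; apply: final_uniq; exact: finset.subsetT.
Qed.

(** Each [f] has exactly one final set in [U]. The result is the recursion of [sum_gen], with [r]
    for [rate l]. *)
Lemma sum_filling U :
  \sum_(S : {set V} | S \subset U)
    wprob level_weight (filling S) * expR (- r #|S|) ^+ #|U :\: S| = 1.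
Proof.
rewrite -[RHS](wprob_total normalized_level_weight).
rewrite (@sum_wprob R _ _ {set V} level_weight predT
  (fun S f => (S \subset U) && final S U f) (fun S => S \subset U)).
- by apply: eq_bigr => S SU; rewrite -wprob_final //; apply: eq_wprob => f; rewrite SU.
- move=> f; apply/esym/existsP.
  by have [S SU fS] := final_exists U f; exists S; rewrite SU.
- by move=> f S S' /andP[SU fS] /andP[S'U fS']; exact: final_uniq fS fS'.
Qed.

End Sellke.

(** * Exponential tail bounds for the size of the final set *)

(** Markov's inequality for an exponential moment, which factorizes; the sign of [t] selects the
    upper or the lower tail. *)
Lemma wprob_chernoff (R : realType) (I X : finType) (w : I -> X -> R)
    (E : {ffun I -> X} -> bool) (g : I -> X -> R) (t a : R) :
  (forall i x, 0 <= w i x) ->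
  (forall f, E f -> 0 <= t * (\sum_i g i (f i) - a)) ->
  wprob w E <= expR (- (t * a)) * \prod_i \sum_x expR (t * g i x) * w i x.
Proof.
move=> w0 Eg; rewrite bigA_distr_bigA mulr_sumr /wprob big_mkcond /=.
apply: ler_sum => f _; rewrite big_split /=.
have W0 : 0 <= \prod_i w i (f i) by apply: prodr_ge0.
rewrite mulrA -expR_sum -mulr_sumr -expRD addrC -mulrBr.
case: ifPn => [/Eg Ef|_]; last by rewrite mulr_ge0 ?expR_ge0.
by rewrite ler_peMl // (le_trans _ (expR_ge1Dx _)) // lerDl.
Qed.

Section FinalSize.
Variables (R : realType) (V : finType) (l : nat -> R).
Hypothesis l_ge0 : forall j, 0 <= l j.
Implicit Types S : {set V}.

Let L (A : {set V}) := l #|A|.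
Let N := #|V|.

Definition final_prob S := wprob (edge_weight L) (fun b => cl b [set: V]%SET == S).

Lemma rate_ge0 k : 0 <= rate l k.
Proof. by apply: sumr_ge0 => i _; rewrite mulr_ge0. Qed.

Lemma rate_mono : {homo rate l : i j / (i <= j)%N >-> i <= j}.
Proof.
move=> i j ij; rewrite /rate.
rewrite (big_ord_widen _ (fun k => 'C(i, k)%:R * l k.+1) (ij : (i < j.+1)%N)).
rewrite big_mkcond /=; apply: ler_sum => k _; case: ifP => _; last by rewrite mulr_ge0.
by rewrite ler_wpM2r // ler_nat leq_bin2l.
Qed.

(** [gen] and the weight of [filling] solve the same triangular recursion, and both sides carry the
    same factor for the vertices outside [S]. *)
Lemma final_probE S :
  final_prob S = wprob (@level_weight R V (rate l)) (final S [set: V]%SET).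
Proof.
rewrite /final_prob wprob_cl_card ?finset.subsetT // wprob_final ?finset.subsetT //.
congr (_ * _).
apply: (@recursion_uniq R V _ (fun S => wprob (@level_weight R V (rate l)) (@filling V S))
  (fun S => expR (- rate l #|S|))).
- exact: sum_gen.
- exact: sum_filling.
Qed.

Lemma edge_weight_ge0 (A : {set V}) x : 0 <= edge_weight L A x.
Proof.
case: x; rewrite /edge_weight ?expR_ge0// subr_ge0 expR_le1 oppr_le0.
exact: l_ge0.
Qed.

Lemma final_prob_ge0 S : 0 <= final_prob S.
Proof. by apply: wprob_ge0; exact: edge_weight_ge0. Qed.

Lemma sum_final_prob : \sum_S final_prob S = 1.
Proof.
rewrite -[RHS](wprob_total (normalized_edge_weight L)).
apply/esym/(@sum_wprob R _ _ {set V} _ predT (fun S b => cl b [set: V]%SET == S)).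
  by move=> b; apply/esym/existsP; exists (cl b [set: V]%SET); rewrite /= eqxx.
by move=> b S S' /eqP<- /eqP.
Qed.

(** The number of levels at most [k] is binomial with success probability 1 - exp(- r_k), and 1 + x
    <= exp x bounds its exponential moment. *)
Lemma sum_final_prob_le (Q : pred {set V}) (k : nat) (t a : R) : (k <= N)%N ->
  (forall S (f : {ffun V -> 'I_#|V|.+2}), Q S -> final S [set: V]%SET f ->
    0 <= t * (#|[set v | (f v <= k)%N]%SET|%:R - a)) ->
  \sum_(S | Q S) final_prob S <=
  expR (- (t * a) + (expR t - 1) * (1 - expR (- rate l k)) * N%:R).
Proof.
move=> kN H; set c := expR (- rate l k).
under eq_bigr do rewrite final_probE.
apply: le_trans (sum_final_le rate_ge0 rate_mono
  (E := fun f => `[< 0 <= t * (#|[set v | (f v <= k)%N]%SET|%:R - a) >]) _) _.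
  by move=> S f QS fS; apply/asboolP; exact: H fS.
apply: le_trans (wprob_chernoff (t := t) (a := a)
  (g := fun _ (x : 'I__) => (x <= k)%N%:R) _ _) _.
- by apply: level_weight_ge0; [exact: rate_ge0|exact: rate_mono].
- move=> f /asboolP; congr (0 <= t * (_ - a)).
  rewrite -sum1_card natr_sum big_mkcond /=.
  by apply: eq_bigr => v _; rewrite inE; case: (f v <= k)%N.
rewrite expRD ler_wpM2l ?expR_ge0//.
have -> : \prod_(v : V) \sum_(x : 'I_#|V|.+2) expR (t * (x <= k)%N%:R) * level_weight (rate l) v x =
    \prod_(v : V) (1 + (expR t - 1) * (1 - c)).
  apply: eq_bigr => v _; rewrite (bigID (fun x : 'I_#|V|.+2 => (k < x)%N)) /=.
  have t1 := normalized_level_weight (rate l) v.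
  rewrite (bigID (fun x : 'I_#|V|.+2 => (k < x)%N)) /= level_weight_tail // -/c in t1.
  rewrite (eq_bigr (level_weight (rate l) v)) => [|x kx]; last first.
    by rewrite leqNgt kx mulr0 expR0 mul1r.
  rewrite level_weight_tail // -/c.
  rewrite [X in _ + X](eq_bigr (fun x => expR t * level_weight (rate l) v x)) => [|x kx]; last first.
    by rewrite leqNgt kx mulr1.
  rewrite -mulr_sumr; move: t1; set y := \sum_(_ | _) _ => t1.
  have -> : y = 1 - c by rewrite -t1; ring.
  by ring.
rewrite prodr_const [_ * N%:R]mulrC expRM_natl.
rewrite lerXn2r ?nnegrE ?expR_ge0 ?expR_ge1Dx //.
have c1 : c <= 1 by rewrite expR_le1 oppr_le0 rate_ge0.
have c0 : 0 <= c by exact: expR_ge0.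
have t0 : 0 <= expR t by exact: expR_ge0.
have -> : 1 + (expR t - 1) * (1 - c) = c + expR t * (1 - c) by ring.
by rewrite addr_ge0 // mulr_ge0 // subr_ge0.
Qed.

(** If the final set has more than [m] vertices, filling at index [m] gives more than [m] levels at
    most [m]. *)
Lemma final_prob_large (m : nat) (t : R) : (m <= N)%N -> 0 <= t ->
  \sum_(S : {set V} | (m < #|S|)%N) final_prob S <=
  expR (- (t * m%:R) + (expR t - 1) * (1 - expR (- rate l m)) * N%:R).
Proof.
move=> mN t0; apply: sum_final_prob_le => // S f mS /andP[/forallP fS _].
rewrite mulr_ge0 // subr_ge0 ler_nat; apply: ltnW.
have /= h := fS (Ordinal mS); apply: leq_trans h _; apply: subset_leq_card.
by apply/fintype.subsetP => v; rewrite !inE => /andP[].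
Qed.

(** All vertices outside a final set of size [k] have level above [k], so at most [k] levels are at
    most [k]. The lower tail is used, with parameter [- t]. *)
Lemma final_prob_card (k : nat) (t : R) : (k <= N)%N -> 0 <= t ->
  \sum_(S : {set V} | #|S| == k) final_prob S <=
  expR (t * k%:R + (expR (- t) - 1) * (1 - expR (- rate l k)) * N%:R).
Proof.
move=> kN t0; rewrite -[t * k%:R]opprK -mulNr.
apply: sum_final_prob_le => // S f /eqP Sk /andP[_ /forall_inP fS].
rewrite mulNr -mulrN opprB mulr_ge0 // subr_ge0 ler_nat -Sk; apply: subset_leq_card.
apply/fintype.subsetP => v; rewrite !inE; apply: contraTT => vS; rewrite -ltnNge.
by apply: fS; rewrite !inE vS.
Qed.

End FinalSize.

(** * Exponential tilting of Poisson hypergraphs *)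

Section Poisson.
Variable R : realType.

Definition poisson_weight (mu : R) (n : nat) : R := expR (- mu) * (mu ^+ n / n`!%:R).

Lemma poisson_weight_ge0 mu n : 0 <= mu -> 0 <= poisson_weight mu n.
Proof. by move=> mu0; rewrite mulr_ge0 ?expR_ge0// mulr_ge0 ?exprn_ge0. Qed.

Lemma poisson_weight_tilt (x mu : R) n :
  x ^+ n * poisson_weight mu n = expR ((x - 1) * mu) * poisson_weight (x * mu) n.
Proof.
rewrite /poisson_weight exprMn.
have -> : expR (- mu) = expR ((x - 1) * mu) * expR (- (x * mu)).
  by rewrite -expRD; congr expR; ring.
by ring.
Qed.

Lemma sum_poisson_weight_le1 (mu : R) K : 0 <= mu ->
  \sum_(n < K) poisson_weight mu n <= 1.
Proof.
move=> mu0; rewrite -mulr_sumr expRN mulrC ler_pdivrMr ?expR_gt0// mul1r.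
have -> : \sum_(n < K) mu ^+ n / n`!%:R = series (exp_coeff mu) K.
  by rewrite /series /= big_mkord.
apply: nondecreasing_cvgn_le; last exact: is_cvg_series_exp_coeff.
by apply: nondecreasing_series => n _ _; exact: exp_coeff_ge0.
Qed.

(** The value 0 keeps its exact mass exp(- l A) under truncation at [K], and the positive values
    have at most the complementary mass. *)
Lemma sum_poisson_weight_edge (V : finType) (l : {set V} -> R) A K (y : bool) :
  0 <= l A ->
  \sum_(n < K.+1 | (0 < n)%N == y) poisson_weight (l A) n <= edge_weight l A y.
Proof.
move=> l0; have s1 := sum_poisson_weight_le1 K.+1 l0.
have p0 : poisson_weight (l A) 0 = expR (- l A).
  by rewrite /poisson_weight expr0 fact0 divr1 mulr1.
rewrite big_ord_recl /= in s1; rewrite big_mkcond big_ord_recl /=; case: y => /=.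
  rewrite add0r lerBrDl -p0; apply: le_trans s1; rewrite lerD2l.
  by apply: ler_sum => i _.
by rewrite p0 big1 ?addr0.
Qed.

End Poisson.

Section Tilting.
Variables (R : realType) (V : finType) (l : nat -> R).
Hypothesis l_ge0 : forall j, 0 <= l j.
Implicit Types S : {set V}.

(** This is G_k, the mean number of edges with at most one vertex outside a set of [k] vertices. *)
Definition compensator k : R :=
  \sum_(i < k.+1) 'C(k, i)%:R * l i + (#|V| - k)%:R * rate l k.

Let near_edges S := [set A : {set V} | (#|A :\: S| <= 1)%N]%SET.

Lemma sum_near_edges S : \sum_(A in near_edges S) l #|A| = compensator #|S|.
Proof.
rewrite /compensator.
rewrite [LHS](bigID (fun A : {set V} => A \subset S)).
congr (_ + _).
  rewrite -(sum_subsets l); apply: eq_bigl => A; rewrite inE.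
  case: (boolP (A \subset S)); rewrite ?andbF// andbT.
  by rewrite -finset.setD_eq0 => /eqP->; rewrite cards0.
have -> : (#|V| - #|S|)%N = #|([set: V] :\: S)%SET|.
  by rewrite finset.setTD [RHS]cardsCs finset.setCK.
rewrite -sum_boundary ?finset.subsetT//.
apply: eq_bigl => A; rewrite inE finset.subsetT -finset.setD_eq0 -cards_eq0 /=.
by case: #|_| => [|[]].
Qed.

Lemma depends_on_final S :
  depends_on (near_edges S) (fun b => cl b [set: V]%SET == S).
Proof.
move=> f g fg; rewrite !(@cl_eqE _ _ S [set: V]%SET) ?finset.subsetT//; congr (_ && _).
  apply: depends_onW (@depends_on_cl V S) _ _ fg; apply/fintype.subsetP => A.
  by rewrite !inE -finset.setD_eq0 => /eqP->; rewrite cards0.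
apply: eq_forallb => A; case: (boolP (_ \in _)) => //=; rewrite inE => /andP[_ /eqP A1].
by rewrite fg // inE A1.
Qed.

(* No edge with [#|A :\: S| = 1] is present when the final set is [S], so tilting
   their rates too costs nothing, and it turns the tilted law restricted to
   [near_edges S] into that of the hypergraph with all rates multiplied by
   [expR t]. *)
Lemma tilting S (t a : R) K :
  wprob (fun (A : {set V}) (n : 'I_K.+1) => poisson_weight (l #|A|) n)
    (fun f => (identifiable_set (fun A : {set V} => f A : nat) == S) &&
       (0 <= t * ((\sum_(A : {set V} | A \subset S) (f A : nat))%:R - a))) <=
  expR (- (t * a) + (expR t - 1) * compensator #|S|) *
  final_prob (fun j => expR t * l j) S.
Proof.
set x := expR t; have x0 : 0 <= x by exact: expR_ge0.
pose xA (A : {set V}) := if A \in near_edges S then x else 1.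
pose l' (A : {set V}) := xA A * l #|A|.
have xA0 A : 0 <= xA A by rewrite /xA; case: ifP.
have l'0 A : 0 <= l' A by rewrite mulr_ge0.
pose occ (f : {ffun {set V} -> 'I_K.+1}) : {ffun {set V} -> bool} := [ffun A => (0 < f A)%N].
have occE (f : {ffun {set V} -> 'I_K.+1}) : identifiable_set (fun A : {set V} => f A : nat) = cl (occ f) [set: V]%SET.
  apply: eq_identifiable_set => A; rewrite lt0b ffunE finset.subsetT andbT.
  by [].
pose F (A : {set V}) (n : 'I_K.+1) := xA A ^+ n * poisson_weight (l #|A|) n.
have F0 A n : 0 <= F A n by rewrite mulr_ge0 ?exprn_ge0 ?poisson_weight_ge0.
(* Edges leaving [S] by one vertex are absent here, so the tilt contributes [x] to the power of the
   number of edges inside [S]; by the second condition, exp(- t a) times this is at least 1. *)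
have step1 : wprob (fun (A : {set V}) (n : 'I_K.+1) => poisson_weight (l #|A|) n)
    (fun f => (identifiable_set (fun A : {set V} => f A : nat) == S) &&
       (0 <= t * ((\sum_(A : {set V} | A \subset S) (f A : nat))%:R - a))) <=
  expR (- (t * a)) * wprob F (fun f => cl (occ f) [set: V]%SET == S).
  rewrite /wprob mulr_sumr big_mkcond [leRHS]big_mkcond /=; apply: ler_sum => f _.
  rewrite occE; case: ifPn => [/andP[/[dup] clf -> ta]|_]; last first.
    case: ifP => // _; apply: mulr_ge0; first exact: expR_ge0.
    by apply: prodr_ge0.
  have nob A : A \in near_edges S -> ~~ (A \subset S) -> f A = 0%N :> nat.
    rewrite inE => A1 AS; have := clf.
    rewrite (@cl_eqE _ _ S [set: V]%SET) ?finset.subsetT// => /andP[_ /forall_inP/(_ A)].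
    rewrite inE finset.subsetT /= ffunE -eqn0Ngt => /(_ _)/eqP; apply.
    by rewrite eqn_leq A1 card_gt0 finset.setD_eq0.
  rewrite [X in _ <= _ * X]big_split /= mulrA ler_peMl //.
    by apply: prodr_ge0 => A _; exact: poisson_weight_ge0.
  have -> : \prod_A xA A ^+ f A = expR (t * (\sum_(A : {set V} | A \subset S) (f A : nat))%:R).
    rewrite natr_sum mulr_sumr expR_sum [RHS]big_mkcond /=; apply: eq_bigr => A _.
    rewrite /xA; case: ifP => An; case: ifPn => AS.
    - by rewrite mulrC expRM_natl.
    - by rewrite nob.
    - by move: An; rewrite inE; move: AS; rewrite -finset.setD_eq0 => /eqP->; rewrite cards0.
    - by rewrite expr1n.
  by rewrite -expRD addrC -mulrBr; apply: le_trans (expR_ge1Dx _); rewrite lerDl.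
apply: le_trans step1 _; rewrite expRD -mulrA ler_wpM2l ?expR_ge0//.
have -> : wprob F (fun f => cl (occ f) [set: V]%SET == S) =
    \sum_(b | cl b [set: V]%SET == S) \prod_A \sum_(n < K.+1 | (0 < n)%N == b A) F A n.
  rewrite /wprob (partition_big occ (fun b => cl b [set: V]%SET == S)) //=.
  apply: eq_bigr => b bS; rewrite bigA_distr_big_dep; apply: eq_bigl => f.
  apply/andP/familyP => [[_ /eqP <-] A|h]; first by rewrite ffunE; exact: eqxx.
  suff -> : occ f = b by [].
  by apply/ffunP => A; rewrite ffunE; have := h A; rewrite unfold_in => /eqP.
(* The event depends only on [near_edges S], where the rates [l'] and [x * l] agree. *)
have -> : final_prob (fun j => x * l j) S =
    wprob (edge_weight l') (fun b => cl b [set: V]%SET == S).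
  apply: (eq_wprob_on (D := near_edges S)); try exact: normalized_edge_weight.
    exact: depends_on_final.
  by move=> A AS y; rewrite /edge_weight /l' /xA AS.
rewrite -sum_near_edges [(x - 1) * _]mulr_sumr [X in expR X]big_mkcond expR_sum /wprob mulr_sumr.
apply: ler_sum => b _; rewrite -big_split /=; apply: ler_prod => A _; apply/andP; split.
  exact: sumr_ge0.
under eq_bigr do rewrite /F poisson_weight_tilt.
rewrite -mulr_sumr.
have -> : (if A \in near_edges S then (x - 1) * l #|A| else 0) = (xA A - 1) * l #|A|.
  by rewrite /xA; case: ifP => // _; rewrite subrr mul0r.
by rewrite ler_wpM2l ?expR_ge0// (sum_poisson_weight_edge (l := l')).
Qed.

End Tilting.

(** * From truncated weights to random hypergraphs *)

(** At mean 0 the Dirac mass agrees with the weight because [0 ^+ 0 = 1]. *)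
Lemma poisson_prob1 (R : realType) (mu : R) n : 0 <= mu ->
  poisson_prob mu 0 [set n] = (poisson_weight mu n)%:E.
Proof.
rewrite /poisson_prob le_eqVlt => /predU1P[<-|mu0].
  rewrite ltxx diracE /poisson_weight oppr0 expR0 mul1r; case: n => [|n].
    by rewrite mem_set// expr0 fact0 divr1.
  by rewrite memNset// expr0n mul0r.
rewrite mu0 esum_set1 ?lee_fin ?poisson_pmf_ge0// /poisson_pmf mu0.
by rewrite /poisson_weight mulrC.
Qed.

(* Truncating the multiplicities at [K] makes all sums finite; upper bounds that
   are uniform in [K] suffice, by continuity from below. *)
Lemma poisson_hypergraph_le d (T : measurableType d) (R : realType)
    (P : probability T R) (beta : nat -> R) (V : finType)
    (L : {set V} -> {RV P >-> nat}) (Q : hypergraph V -> bool) (c : R) :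
  (forall j, 0 <= beta j) -> poisson_hypergraph beta L ->
  (forall K, wprob (fun (A : {set V}) (n : 'I_K.+1) =>
      poisson_weight (#|V|%:R * beta #|A| / 'C(#|V|, #|A|)%:R) n)
    (fun f => Q (fun A : {set V} => f A)) <= c) ->
  (P [set w | Q (hypergraph_at L w)] <= c%:E)%E.
Proof.
move=> beta0 [indL distL] hK; set E := [set w | _].
pose C K (f : {ffun {set V} -> 'I_K.+1}) : set T :=
  if Q (fun A : {set V} => f A) then \bigcap_(A in [set` [set: {set V}]%SET]) (L A @^-1` [set (f A : nat)])
  else set0.
pose EK K := \bigcup_(f in [set: {ffun {set V} -> 'I_K.+1}]) C K f.
have mC K f : measurable (C K f).
  rewrite /C; case: ifP => // _; apply: fin_bigcap_measurable => // A _.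
  by rewrite -[X in measurable X]setTI; exact: measurable_funP.
have mE K : measurable (EK K).
  by apply: fin_bigcup_measurable => //.
have CE K f w : C K f w -> Q (hypergraph_at L w) /\ forall A, L A w = f A :> nat.
  rewrite /C; case: ifP => // Qf h; have e A : L A w = f A by apply: h; rewrite /= inE.
  by split=> //; rewrite (_ : hypergraph_at L w = (fun A => f A)) //; apply/funext.
have EE : E = \bigcup_K EK K.
  apply/seteqP; split=> [w Ew|w [K _ [f _ /CE[]]] //].
  (* The largest multiplicity of an outcome serves as its truncation level. *)
  exists (\max_A L A w)%N => //.
  exists [ffun A => inord (L A w)] => //; rewrite /C.
  have e A : (([ffun A => inord (L A w)] : {ffun {set V} -> 'I_(\max_A L A w).+1}) A : nat) = L A w.
    by rewrite ffunE inordK // ltnS leq_bigmax.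
  rewrite ifT => [A _ /=|]; first by rewrite e.
  by rewrite (_ : (fun A => _) = hypergraph_at L w) //; apply/funext => A; rewrite e.
have ndE : nondecreasing_seq EK.
  move=> K K' KK'; apply/subsetPset => w [f _ /CE[Qw fw]].
  exists [ffun A => inord (f A)] => //; rewrite /C.
  have e A : (([ffun A => inord (f A)] : {ffun {set V} -> 'I_K'.+1}) A : nat) = L A w.
    by rewrite ffunE inordK // (leq_trans (ltn_ord _)).
  rewrite ifT => [A _ /=|]; first by rewrite e.
  by rewrite (_ : (fun A => _) = hypergraph_at L w) //; apply/funext => A; rewrite e.
have PEK K : (P (EK K) <= c%:E)%E.
  rewrite /EK measure_fin_bigcup //; [|exact: finite_finset|]; last first.
    move=> f g _ _ [w [/CE[_ ef] /CE[_ eg]]]; apply/ffunP => A; apply/val_inj.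
    by rewrite /= -ef -eg.
  rewrite (fsbigE (index_enum _)) ?index_enum_uniq//; last first.
    by move=> f _; rewrite mem_index_enum.
  rewrite (eq_bigl predT) => [|f]; last exact: in_setT.
  apply: (@le_trans _ _ ((wprob (fun (A : {set V}) (n : 'I_K.+1) =>
      poisson_weight (#|V|%:R * beta #|A| / 'C(#|V|, #|A|)%:R) n)
    (fun f => Q (fun A : {set V} => f A)))%:E)%E); last by rewrite lee_fin.
  rewrite /wprob -sumEFin [leRHS]big_mkcond /=; apply: lee_sum => f _.
  rewrite /C; case: ifP => _; last by rewrite measure0.
  rewrite indL // -prodEFin.
  rewrite (eq_bigl predT) => [|A]; last by rewrite inE.
  rewrite le_eqVlt; apply/orP; left; apply/eqP; apply: eq_bigr => A _.
  by rewrite -poisson_prob1 ?mulr_ge0// -distL.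
rewrite EE; have cv := @nondecreasing_cvg_mu _ _ _ P EK mE (bigcup_measurable (fun K _ => mE K)) ndE.
rewrite -(cvg_lim _ cv) //; apply: lime_le; first by apply/cvg_ex; exists (P (\bigcup_K EK K)).
by apply: nearW => K; exact: PEK.
Qed.

(** * Power series and the threshold *)

Section PowerSums.
Variables (R : realType) (beta : nat -> R).
Hypothesis beta_ge0 : forall j, 0 <= beta j.

Definition psum J t : R := \sum_(j < J) beta j * t ^+ j.

(** With the index shifted by one, [dpsum J] is the derivative of [psum J.+1]. *)
Definition dpsum J t : R := \sum_(i < J) i.+1%:R * beta i.+1 * t ^+ i.

Lemma psum_le_power_sum J t : 0 <= t -> ((psum J t)%:E <= power_sum beta t)%E.
Proof.
move=> t0; rewrite /psum -sumEFin -(big_mkord xpredT (fun j => (beta j * t ^+ j)%:E)).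
by apply: nneseries_lim_ge => i _ _; rewrite lee_fin mulr_ge0 ?exprn_ge0.
Qed.

Lemma psum_power_sum_lt (t c : R) : 0 <= t -> (c%:E < power_sum beta t)%E ->
  exists J, c < psum J t.
Proof.
move=> t0 ct; apply: contrapT => /forallNP h; move: ct; apply/negP; rewrite -leNgt.
apply: lime_le; first by apply: is_cvg_nneseries => i _ _; rewrite lee_fin mulr_ge0 ?exprn_ge0.
by apply: nearW => n; rewrite big_mkord sumEFin lee_fin leNgt; apply/negP/h.
Qed.

Lemma dpsum_le_power_sum' J t : 0 <= t -> ((dpsum J t)%:E <= power_sum' beta t)%E.
Proof.
move=> t0; rewrite /dpsum -sumEFin.
rewrite -(big_mkord xpredT (fun j => (j.+1%:R * beta j.+1 * t ^+ j)%:E)).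
have -> : (\sum_(0 <= j < J) (j.+1%:R * beta j.+1 * t ^+ j)%:E)%E =
    (\sum_(1 <= j < J.+1) (j%:R * beta j * t ^+ j.-1)%:E)%E by rewrite big_add1.
by apply: nneseries_lim_ge => i _ _; rewrite lee_fin !mulr_ge0 ?exprn_ge0.
Qed.

Lemma dpsum_power_sum'_lt (t c : R) : 0 <= t -> (c%:E < power_sum' beta t)%E ->
  exists J, c < dpsum J t.
Proof.
move=> t0 ct; apply: contrapT => /forallNP h; move: ct; apply/negP; rewrite -leNgt.
apply: lime_le; first by apply: is_cvg_nneseries => i _ _; rewrite lee_fin !mulr_ge0 ?exprn_ge0.
apply: nearW => n; case: n => [|n].
  rewrite big_geq // lee_fin; have := h 0%N; rewrite /dpsum big_ord0 => /negP.
  by rewrite -leNgt.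
by rewrite big_add1 /= big_mkord sumEFin lee_fin leNgt; apply/negP/h.
Qed.

Lemma psum_ge0 J t : 0 <= t -> 0 <= psum J t.
Proof. by move=> t0; apply: sumr_ge0 => i _; rewrite mulr_ge0 ?exprn_ge0. Qed.

Lemma dpsum_ge0 J t : 0 <= t -> 0 <= dpsum J t.
Proof. by move=> t0; apply: sumr_ge0 => i _; rewrite !mulr_ge0 ?exprn_ge0. Qed.

Lemma dpsum_monoJ J J' t : 0 <= t -> (J <= J')%N -> dpsum J t <= dpsum J' t.
Proof.
move=> t0 JJ'; rewrite /dpsum (big_ord_widen _ (fun i => i.+1%:R * beta i.+1 * t ^+ i) JJ').
by rewrite big_mkcond; apply: ler_sum => i _; case: ifP; rewrite // !mulr_ge0 ?exprn_ge0.
Qed.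

Lemma psum_monoJ J J' t : 0 <= t -> (J <= J')%N -> psum J t <= psum J' t.
Proof.
move=> t0 JJ'; rewrite /psum (big_ord_widen _ (fun i => beta i * t ^+ i) JJ').
by rewrite big_mkcond; apply: ler_sum => i _; case: ifP; rewrite // !mulr_ge0 ?exprn_ge0.
Qed.

Lemma dpsum_mono J s t : 0 <= s -> s <= t -> dpsum J s <= dpsum J t.
Proof.
move=> s0 st; apply: ler_sum => i _; rewrite ler_wpM2l ?mulr_ge0//.
by rewrite lerXn2r// nnegrE (le_trans s0).
Qed.

(** Mean value inequality: with nonnegative coefficients the derivative on [s, t] is largest at
    [t]. *)
Lemma psum_increment J s t : 0 <= s -> s <= t ->
  psum J t <= psum J s + (t - s) * dpsum J t.
Proof.
move=> s0 st; have t0 := le_trans s0 st.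
have pow j : t ^+ j.+1 - s ^+ j.+1 <= (t - s) * (j.+1%:R * t ^+ j).
  elim: j => [|j IH]; first by rewrite !expr1 expr0 !mulr1.
  have sj : s ^+ j.+1 <= t ^+ j.+1 by rewrite lerXn2r.
  have -> : t ^+ j.+2 - s ^+ j.+2 = t * (t ^+ j.+1 - s ^+ j.+1) + (t - s) * s ^+ j.+1.
    by rewrite !exprS; ring.
  have -> : (t - s) * (j.+2%:R * t ^+ j.+1) =
      t * ((t - s) * (j.+1%:R * t ^+ j)) + (t - s) * t ^+ j.+1.
    by rewrite -natr1 !exprS; ring.
  by apply: lerD; rewrite ler_wpM2l// subr_ge0.
case: J => [|J]; first by rewrite /psum /dpsum !big_ord0 mulr0 addr0.
apply: (@le_trans _ _ (psum J.+1 s + (t - s) * dpsum J t)); last first.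
  by rewrite lerD2l ler_wpM2l ?subr_ge0// dpsum_monoJ.
rewrite /psum !big_ord_recl /= !expr0 -addrA lerD2l -lerBlDl -sumrB mulr_sumr.
apply: ler_sum => i _; rewrite /bump /= add1n -mulrBr [_%:R * beta _]mulrC -mulrA.
by rewrite mulrCA ler_wpM2l.
Qed.

End PowerSums.

Section Threshold.
Variables (R : realType) (beta : nat -> R).
Hypothesis beta_ge0 : forall j, 0 <= beta j.
Hypothesis zstar_lt1 : zstar beta < 1.
Let z := zstar beta.
Let I := ereal_inf [set t%:E | t in [set t : R | 0 <= t < 1 /\ (drift beta t < 0)%E]].

(** Since z < 1, the minimum with 1 is the infimum itself, which is therefore finite. *)
Lemma zstar_ereal_inf : I = z%:E.
Proof.
have I0 : (0%:E <= I)%E.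
  by apply: le_ereal_inf_tmp => _ [t [/andP[t0 _] _] <-]; rewrite lee_fin.
have : fine (Order.min I 1%:E) < 1 := zstar_lt1.
rewrite /z /zstar -/I; move: I0; case: I => [r| |] //= r0.
- by rewrite -EFin_min /= => r1; congr (_%:E); move: r1; rewrite minEle; case: ifP; rewrite ?ltxx.
- by rewrite /Order.min /= ltxx.
Qed.

Lemma zstar_ge0 : 0 <= z.
Proof.
rewrite -lee_fin -zstar_ereal_inf; apply: le_ereal_inf_tmp => _ [t [/andP[t0 _] _] <-].
by rewrite lee_fin.
Qed.

(** The infimum is approached by points of negative drift; there beta' is finite, and [p] is its
    value. *)
Lemma zstar_above (e : R) : 0 < e ->
  exists t p, [/\ z <= t, t < z + e, t < 1, p < - ln (1 - t) & forall J, dpsum beta J t <= p].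
Proof.
move=> e0; have If : I \is a fin_num by rewrite zstar_ereal_inf.
have [_ [t [/andP[t0 t1] dt] <-] te] := lb_ereal_inf_adherent e0 If.
have zt : (I <= t%:E)%E by apply: ereal_inf_lbound; exists t => //; split => //; apply/andP.
rewrite -/I zstar_ereal_inf in te zt.
have h := dpsum_le_power_sum' beta_ge0 _ t0.
move: dt h; rewrite /drift; case: (power_sum' beta t) => [p| |] //=; last first.
  by move=> _ /(_ 0%N).
rewrite -EFinD lte_fin => pt h; exists t, p; split => //.
by move: pt; lra.
Qed.

Hypothesis zeta0 : zeta beta = set0.

(** Below [z] the drift is not negative, by the infimum, and not 0, as [zeta] is empty. It is thus
    positive, possibly infinite, and some partial sum already shows it. *)
Lemma zstar_below (t : R) : 0 <= t -> t < z -> exists J, - ln (1 - t) < dpsum beta J t.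
Proof.
move=> t0 tz; apply: dpsum_power_sum'_lt => //.
have t1 : t < 1 := lt_trans tz zstar_lt1.
have n1 : ~ (drift beta t < 0)%E.
  move=> dt; have : (I <= t%:E)%E by apply: ereal_inf_lbound; exists t => //; split => //; apply/andP.
  by rewrite zstar_ereal_inf lee_fin leNgt tz.
have n2 : drift beta t != 0%E.
  apply/eqP => dt; have : zeta beta t by split => //; apply/andP.
  by rewrite zeta0.
have : (0 < drift beta t)%E by rewrite lt_def n2 /= leNgt; apply/negP.
rewrite /drift; case: (power_sum' beta t) => [p| |]; rewrite ?ltry//.
by rewrite -EFinD !lte_fin; lra.
Qed.

(** By [psum_increment] from 0, the partial sums at [z] are at most beta_0 + z p, where [p] is the
    finite value of beta' at some t >= z. *)
Lemma power_sum_zstar : power_sum beta z \is a fin_num.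
Proof.
have [t [p [zt _ _ _ dp]]] := zstar_above ltr01.
have z0 := zstar_ge0; have t0 := le_trans z0 zt.
have h : (power_sum beta z <= (beta 0 + z * p)%:E)%E.
  rewrite leNgt; apply/negP => /(psum_power_sum_lt beta_ge0 z0)[J].
  apply/negP; rewrite -leNgt; case: J => [|J].
    by rewrite /psum big_ord0 addr_ge0// mulr_ge0// (le_trans _ (dp 0%N))// /dpsum big_ord0.
  have := psum_increment beta_ge0 J.+1 (lexx 0) z0; rewrite subr0.
  have -> : psum beta J.+1 0 = beta 0.
    rewrite /psum big_ord_recl /= expr0 mulr1 big1 ?addr0// => i _.
    by rewrite expr0n mulr0.
  move=> /le_trans; apply; rewrite lerD2l ler_wpM2l//.
  exact: le_trans (dpsum_mono beta_ge0 _ z0 zt) (dp _).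
rewrite ge0_fin_numE; first exact: le_lt_trans h (ltry _).
by apply: le_trans (psum_le_power_sum beta_ge0 0 z0); rewrite lee_fin psum_ge0.
Qed.

End Threshold.

(** * Elementary exponential estimates *)

Lemma expR_le_quadratic (R : realType) (t : R) : `|t| <= 2^-1 ->
  expR t <= 1 + t + 2 * t ^+ 2.
Proof.
rewrite ler_norml => /andP[t1 t2]; have tN := expR_ge1Dx (- t).
have t0 : 0 < 1 - t by lra.
have : expR t <= (1 - t)^-1 by rewrite -[t]opprK expRN opprK lef_pV2 ?posrE ?expR_gt0.
move=> /le_trans; apply; rewrite -div1r ler_pdivrMr //.
have : 0 <= t ^+ 2 * (1 - 2 * t) by rewrite mulr_ge0 ?sqr_ge0//; lra.
by nra.
Qed.

(** One [t] serves both tails. The linear term gains t eta n; for small [t] the quadratic error 2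
    t^2 G costs at most half of it, and [kappa] is the other half. *)
Lemma chernoff_exponent (R : realType) (eta C : R) : 0 < eta -> 0 <= C ->
  exists t kappa, [/\ 0 < t, 0 < kappa & forall n G a, 0 <= n -> 0 <= G -> G <= C * n ->
    (G + eta * n <= a -> - (t * a) + (expR t - 1) * G <= - (kappa * n)) /\
    (a + eta * n <= G -> t * a + (expR (- t) - 1) * G <= - (kappa * n))].
Proof.
move=> eta0 C0; pose t := Num.min 2^-1 (eta / (4 * (C + 1))).
have t0 : 0 < t by rewrite lt_min invr_gt0 ltr0n divr_gt0 // mulr_gt0 //; lra.
have t1 : t <= 2^-1 by rewrite ge_min lexx.
have tC : t * C <= eta / 4.
  apply: (@le_trans _ _ (eta / (4 * (C + 1)) * C)).
    by rewrite ler_wpM2r // ge_min lexx orbT.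
  have C1 : 0 < C + 1 by lra.
  have -> : eta / (4 * (C + 1)) * C = eta / 4 * (C / (C + 1)) by field; rewrite gt_eqF.
  by rewrite ler_piMr ?divr_ge0 ?(ltW eta0)// ler_pdivrMr//; lra.
exists t, (t * eta / 2); split => // [|n G a n0 G0 GC].
  by rewrite divr_gt0 ?mulr_gt0.
have q1 : expR t <= 1 + t + 2 * t ^+ 2 by apply: expR_le_quadratic; rewrite gtr0_norm.
have q2 : expR (- t) <= 1 - t + 2 * t ^+ 2.
  by rewrite -[t ^+ 2]sqrrN; apply: expR_le_quadratic; rewrite normrN gtr0_norm.
have tG : 2 * t ^+ 2 * G <= t * eta * n / 2.
  have -> : 2 * t ^+ 2 * G = 2 * t * (t * G) by ring.
  have -> : t * eta * n / 2 = 2 * t * (eta / 4 * n) by field.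
  rewrite ler_wpM2l ?mulr_ge0 ?(ltW t0)//.
  apply: (@le_trans _ _ (t * C * n)); last by rewrite ler_wpM2r.
  by rewrite -mulrA ler_wpM2l // ltW.
have e1 : (expR t - 1) * G <= (t + 2 * t ^+ 2) * G by rewrite ler_wpM2r//; lra.
have e2 : (expR (- t) - 1) * G <= (- t + 2 * t ^+ 2) * G by rewrite ler_wpM2r//; lra.
split=> h.
  have : t * (G + eta * n) <= t * a by rewrite ler_wpM2l// ltW.
  by lra.
have : t * (a + eta * n) <= t * G by rewrite ler_wpM2l// ltW.
by lra.
Qed.

(** [N.+1] counts the possible sizes in a union bound; exp x >= (x / 2)^2 for x >= 0 beats it. *)
Lemma near_mulr_expR_le (R : realType) (kappa e : R) : 0 < kappa -> 0 < e ->
  \forall N \near \oo, N.+1%:R * expR (- (kappa * N%:R)) <= e.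
Proof.
move=> k0 e0; near=> N.
have N0 : (0 < N)%N by near: N; exact: nbhs_infty_gt.
have Nr : 0 < N%:R :> R by rewrite ltr0n.
rewrite expRN ler_pdivrMr ?expR_gt0//.
have hE : expR (kappa * N%:R) = expR (kappa * N%:R / 2) ^+ 2.
  by rewrite -expRM_natl; congr expR; field.
have h1 := expR_ge1Dx (kappa * N%:R / 2).
have h2 : (kappa * N%:R / 2) ^+ 2 <= expR (kappa * N%:R).
  have kN : 0 <= kappa * N%:R / 2 by rewrite divr_ge0 // mulr_ge0 // ltW.
  by rewrite hE lerXn2r ?nnegrE ?expR_ge0//; lra.
apply: (@le_trans _ _ (e * (kappa * N%:R / 2) ^+ 2)); last by rewrite ler_wpM2l// ltW.
apply: (@le_trans _ _ (2 * N%:R)).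
  by rewrite -natrM ler_nat mul2n -addnn -addn1 leq_add2l.
have -> : e * (kappa * N%:R / 2) ^+ 2 = (e * kappa ^+ 2 / 4 * N%:R) * N%:R by field.
rewrite ler_wpM2r // -ler_pdivrMl; last by rewrite divr_gt0 // mulr_gt0// exprn_gt0.
by near: N; exact: nbhs_infty_ger.
Unshelve. all: by end_near. Qed.

(** * Rates and their limits *)

Section Rates.
Variables (R : realType) (beta : nat -> R).
Hypothesis beta_ge0 : forall j, 0 <= beta j.

Definition edge_rate (N j : nat) : R := N%:R * beta j / 'C(N, j)%:R.

Lemma edge_rate_ge0 N j : 0 <= edge_rate N j.
Proof. by rewrite divr_ge0 ?mulr_ge0. Qed.

(** By induction on [i]: each new factor satisfies k - i <= t (M - i), as t <= 1. *)
Lemma bin_le_expr (t : R) (k M i : nat) : 0 <= t <= 1 -> k%:R <= t * M%:R ->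
  'C(k, i)%:R <= t ^+ i * 'C(M, i)%:R.
Proof.
move=> /andP[t0 t1] kM; elim: i => [|i IH]; first by rewrite !bin0 expr0 mulr1.
have [ik|ki] := leqP k i; first by rewrite bin_small // mulr_ge0 ?exprn_ge0.
have kM' : (k <= M)%N.
  by rewrite -(ler_nat R) (le_trans kM) // ler_piMl.
rewrite -(ler_pM2l (_ : 0 < i.+1%:R :> R)) ?ltr0n// mulrCA -!natrM !mul_bin_left !natrM.
rewrite exprS mulrACA; apply: ler_pM => //.
rewrite !natrB ?(ltnW ki) ?(leq_trans (ltnW ki))// mulrBr lerB//.
by rewrite ler_piMl.
Qed.

(** Each factor k - i with i < J is at least s M, by the reserve of [J]. The case s = 0 is separate
    since [k] may be below [J]. *)
Lemma expr_le_bin (s : R) (k M J i : nat) : 0 <= s -> s = 0 \/ s * M%:R + J%:R <= k%:R ->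
  (i <= J)%N -> s ^+ i * 'C(M, i)%:R <= 'C(k, i)%:R.
Proof.
move=> s0 [->|sk].
  by case: i => [|i] _; [rewrite !bin0 expr0 mulr1|rewrite expr0n mul0r].
have Jk : (J <= k)%N by rewrite -(ler_nat R) (le_trans _ sk)// lerDr mulr_ge0.
elim: i => [|i IH] iJ; first by rewrite !bin0 expr0 mulr1.
rewrite -(ler_pM2l (_ : 0 < i.+1%:R :> R)) ?ltr0n// mulrCA -!natrM !mul_bin_left !natrM.
rewrite exprS mulrACA; apply: ler_pM => //; rewrite ?mulr_ge0 ?exprn_ge0//; last exact/IH/ltnW.
apply: (@le_trans _ _ (s * M%:R)); first by rewrite ler_wpM2l // ler_nat leq_subr.
rewrite natrB ?(leq_trans (ltnW iJ))// lerBrDr (le_trans _ sk)// lerD2l ler_nat.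
exact: ltnW.
Qed.

(** From (M + 1) C(M, i) = (i + 1) C(M + 1, i + 1); the remaining ratios of binomials are compared
    with powers of k / M. *)
Lemma rateE M k : rate (edge_rate M.+1) k =
  \sum_(i < k.+1) i.+1%:R * beta i.+1 * ('C(k, i)%:R / 'C(M, i)%:R).
Proof.
apply: eq_bigr => i _; rewrite /edge_rate.
have [iM|Mi] := leqP i M; last first.
  (* Both denominators are 0, with inverse 0 by convention, so both sides vanish. *)
  by rewrite (@bin_small M.+1)// (@bin_small M)// !invr0 !mulr0.
have := congr1 (fun n => n%:R : R) (mul_bin_diag M.+1 i); rewrite /= !natrM => e.
have C1 : 'C(M, i)%:R != 0 :> R by rewrite pnatr_eq0 -lt0n bin_gt0.
have C2 : 'C(M.+1, i.+1)%:R != 0 :> R by rewrite pnatr_eq0 -lt0n bin_gt0.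
have -> : M.+1%:R = i.+1%:R * 'C(M.+1, i.+1)%:R / 'C(M, i)%:R :> R.
  by rewrite -e mulfK.
by field; rewrite C1.
Qed.

Lemma rate_le (t : R) (k M : nat) : 0 <= t <= 1 -> k%:R <= t * M%:R ->
  rate (edge_rate M.+1) k <= dpsum beta k.+1 t.
Proof.
move=> t01 kM; rewrite rateE; apply: ler_sum => i _; rewrite ler_wpM2l ?mulr_ge0//.
have [iM|Mi] := leqP i M; last first.
  by rewrite (@bin_small M) // invr0 mulr0 exprn_ge0 //; case/andP: t01.
by rewrite ler_pdivrMr ?ltr0n ?bin_gt0// bin_le_expr.
Qed.

(** With [rate_le], this traps r_k between partial sums of beta' at points on either side of k /
    M. *)
Lemma rate_ge (s : R) (k M J : nat) : 0 <= s -> (k <= M.+1)%N ->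
  s = 0 \/ s * M%:R + J%:R <= k%:R -> dpsum beta J s <= rate (edge_rate M.+1) k.
Proof.
move=> s0 kM sk; rewrite rateE /dpsum.
pose n := maxn J k.+1.
rewrite (big_ord_widen n (fun i => i.+1%:R * beta i.+1 * s ^+ i)) ?leq_maxl//.
rewrite (big_ord_widen n (fun i => i.+1%:R * beta i.+1 * ('C(k, i)%:R / 'C(M, i)%:R))) ?leq_maxr//.
rewrite big_mkcond [leRHS]big_mkcond; apply: ler_sum => i _.
have h0 : 0 <= i.+1%:R * beta i.+1 * ('C(k, i)%:R / 'C(M, i)%:R).
  by rewrite !mulr_ge0 ?invr_ge0.
case: ifP => [iJ|_]; last by case: ifP.
suff h : i.+1%:R * beta i.+1 * s ^+ i <= i.+1%:R * beta i.+1 * ('C(k, i)%:R / 'C(M, i)%:R).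
  case: ifPn => //; rewrite -leqNgt => ki.
  by rewrite (le_trans h) // bin_small// mul0r mulr0.
rewrite ler_wpM2l ?mulr_ge0//.
have [iM|Mi] := leqP i M.
  by rewrite ler_pdivlMr ?ltr0n ?bin_gt0// (expr_le_bin (J := J)) // ltnW.
case: sk => [->|sk].
  by rewrite expr0n; case: (val i) Mi => // n' _; rewrite divr_ge0.
have Jk : (J <= k)%N by rewrite -(ler_nat R) (le_trans _ sk)// lerDr mulr_ge0.
by have := leq_trans iJ (leq_trans Jk kM); rewrite ltnS leqNgt Mi.
Qed.

Lemma inner_le (t : R) (k N : nat) : 0 <= t <= 1 -> k%:R <= t * N%:R ->
  \sum_(i < k.+1) 'C(k, i)%:R * edge_rate N i <= N%:R * psum beta k.+1 t.
Proof.
move=> t01 kN; rewrite mulr_sumr; apply: ler_sum => i _; rewrite /edge_rate.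
have [iM|Mi] := leqP i N; last first.
  by rewrite (@bin_small N) // invr0 !mulr0 !mulr_ge0 ?exprn_ge0//; case/andP: t01.
rewrite mulrA ler_pdivrMr ?ltr0n ?bin_gt0//.
have := bin_le_expr i t01 kN => h; rewrite mulrC -!mulrA ler_wpM2l// ler_wpM2l//.
Qed.

Lemma inner_ge (s : R) (k N J : nat) : 0 <= s -> (k <= N)%N ->
  s = 0 \/ s * N%:R + J%:R <= k%:R ->
  N%:R * psum beta J s <= \sum_(i < k.+1) 'C(k, i)%:R * edge_rate N i.
Proof.
move=> s0 kN sk; rewrite /psum mulr_sumr.
pose n := maxn J k.+1.
rewrite (big_ord_widen n (fun i => N%:R * (beta i * s ^+ i))) ?leq_maxl//.
rewrite (big_ord_widen n (fun i => 'C(k, i)%:R * edge_rate N i)) ?leq_maxr//.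
rewrite big_mkcond [leRHS]big_mkcond; apply: ler_sum => i _.
have h0 : 0 <= 'C(k, i)%:R * edge_rate N i by rewrite mulr_ge0 ?edge_rate_ge0.
case: ifP => [iJ|_]; last by case: ifP.
suff h : N%:R * (beta i * s ^+ i) <= 'C(k, i)%:R * edge_rate N i.
  case: ifPn => //; rewrite -leqNgt => ki.
  by rewrite (le_trans h) // bin_small// mul0r.
have [iN|Ni] := leqP i N; last first.
  case: sk => [->|sk].
    by rewrite expr0n; case: (val i) Ni h0 => // n' _ h0; rewrite !mulr0.
  have Jk : (J <= k)%N by rewrite -(ler_nat R) (le_trans _ sk)// lerDr mulr_ge0.
  by have := leq_trans iJ (leq_trans Jk kN); rewrite ltnNge ltnW.
rewrite /edge_rate [leRHS]mulrA ler_pdivlMr ?ltr0n ?bin_gt0// [leRHS]mulrC -!mulrA.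
by rewrite ler_wpM2l// ler_wpM2l// (expr_le_bin (J := J)) // ltnW.
Qed.

End Rates.

(** * Uniform positivity of the drift on compact intervals *)

Section Dini.
Variables (R : realType) (beta : nat -> R).
Hypothesis beta_ge0 : forall j, 0 <= beta j.

Lemma continuous_dpsum J : continuous (dpsum beta J).
Proof.
rewrite (_ : dpsum beta J = horner (\poly_(i < J) (i.+1%:R * beta i.+1))).
  exact: continuous_horner.
by apply/funext => t; rewrite horner_poly.
Qed.

Lemma continuous_psum J : continuous (psum beta J).
Proof.
rewrite (_ : psum beta J = horner (\poly_(i < J) beta i)); first exact: continuous_horner.
by apply/funext => t; rewrite horner_poly.
Qed.

(** Compactness as in Dini's theorem: positivity at a point spreads to a neighbourhood by continuity
    and to larger [J] by monotonicity. *)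
Lemma dini (b : R) : b < 1 ->
  (forall t, 0 <= t <= b -> exists J, - ln (1 - t) < dpsum beta J t) ->
  exists J eta, 0 < eta /\
    forall t, 0 <= t <= b -> t + eta <= 1 - expR (- dpsum beta J t).
Proof.
move=> b1 H; pose h J t := 1 - expR (- dpsum beta J t) - t.
have hcont J : continuous (h J).
  move=> t; apply: cvgB; last exact: cvg_id.
  apply: cvgB; first exact: cvg_cst.
  apply: (@continuous_cvg _ _ _ _ _ _ expR); first exact: continuous_expR.
  by apply: cvgN; exact: continuous_dpsum.
have cov := proj1 (compact_near_coveringP _) (@segment_compact R 0 b).
(* [J] is both the truncation index and, through its inverse, the lower bound, so one covering
   argument yields both. *)
have /filter_ex[J hJ] : \forall J \near \oo, `[0, b]%classic `<=` (fun t => 0 <= t -> J.+1%:R^-1 <= h J t).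
  apply: cov => t; rewrite /= in_itv /= => t0b; have [J0 hJ0] := H t t0b.
  have t1 : 0 < 1 - t by case/andP: t0b => _ tb; rewrite subr_gt0 (le_lt_trans tb).
  have ht : 0 < h J0 t.
    rewrite /h subr_gt0 ltrBrDl -ltrBrDr -[ltRHS]lnK ?posrE// ltr_expR.
    by rewrite ltrNl.
  near=> t' J => t'0.
  have hJ0t' : h J0 t / 2 < h J0 t'.
    near: t'; apply: (cvgr_gt (h J0 t)); first exact: hcont.
    by rewrite ltr_pdivrMr // ltr_pMr // ltr1n.
  have JJ0 : (J0 <= J)%N by near: J; exact: nbhs_infty_ge.
  have Jh : J.+1%:R^-1 <= h J0 t / 2.
    rewrite -[leRHS]invrK lef_pV2 ?posrE ?invr_gt0 ?divr_gt0//.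
    apply: (@le_trans _ _ J%:R); last by rewrite ler_nat.
    by near: J; exact: nbhs_infty_ger.
  apply: (le_trans Jh); apply: (le_trans (ltW hJ0t')).
  by rewrite /h lerB// lerD2l lerN2 ler_expR lerN2 dpsum_monoJ.
exists J, J.+1%:R^-1; split; first by rewrite invr_gt0.
move=> t t0b; have := hJ t; rewrite /= in_itv /= => /(_ t0b).
by case/andP: t0b => t0 _ /(_ t0); rewrite /h lerBrDl.
Unshelve. all: by end_near. Qed.

End Dini.

(** * Concentration *)

Section Concentration.
Variables (R : realType) (beta : nat -> R).
Hypothesis beta_ge0 : forall j, 0 <= beta j.
Hypothesis zstar_lt1 : zstar beta < 1.
Hypothesis zeta0 : zeta beta = set0.
Let z := zstar beta.
Let z0 : 0 <= z := zstar_ge0 zstar_lt1.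

(** Union over the sizes k <= b N, each bounded by [final_prob_card]: by [dini] the mean number of
    levels up to [k] exceeds [k] by a multiple of N. *)
Lemma final_prob_below (b e : R) : b < z -> 0 < e ->
  \forall N \near \oo, forall V : finType, #|V| = N ->
    \sum_(S : {set V} | #|S|%:R <= b * N%:R) final_prob (edge_rate beta N) S <= e.
Proof.
move=> bz e0; have [b0|b0] := leP 0 b; last first.
  near=> N => V VN; rewrite big_pred0 ?ltW// => S; apply/negbTE; rewrite -ltNge.
  rewrite (lt_le_trans _ (ler0n _ _))// nmulr_rlt0 // ltr0n.
  by near: N; exact: nbhs_infty_gt.
have bz1 : b < 1 by rewrite (lt_trans bz).
have [|J [eta [eta0 hJ]]] := dini beta_ge0 bz1.
  by move=> t /andP[t0 tb]; apply: zstar_below => //; exact: le_lt_trans tb bz.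
(* Half of the margin is kept for the shift by [J] in the choice of [s] below. *)
have eta2 : 0 < eta / 2 by rewrite divr_gt0.
have [t [kappa [t0 kappa0 tk]]] := chernoff_exponent eta2 ler01.
near=> N => V VN.
have N0 : (0 < N)%N by near: N; exact: nbhs_infty_gt.
have Nr : 0 < N%:R :> R by rewrite ltr0n.
have JN : J%:R <= eta / 2 * N%:R.
  by rewrite -ler_pdivrMl//; near: N; exact: nbhs_infty_ger.
have Ne : N.+1%:R * expR (- (kappa * N%:R)) <= e by near: N; exact: near_mulr_expR_le.
apply: le_trans Ne.
have lge0 := edge_rate_ge0 beta_ge0 N.
rewrite (partition_big (fun S : {set V} => inord #|S| : 'I_N.+1) predT) //=.
have -> : N.+1%:R * expR (- (kappa * N%:R)) = \sum_(k < N.+1) expR (- (kappa * N%:R)).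
  by rewrite sumr_const card_ord mulr_natl.
apply: ler_sum => k _; have kN : (k <= #|V|)%N by rewrite VN -ltnS.
have [kb|kb] := leP k%:R (b * N%:R); last first.
  rewrite big_pred0 ?expR_ge0// => S; apply/negbTE/negP => /andP[Sb /eqP Sk].
  move: kb; rewrite -Sk inordK ?ltNge ?Sb// ltnS -VN max_card.
  by [].
apply: (@le_trans _ _ (\sum_(S : {set V} | #|S| == k) final_prob (edge_rate beta N) S)).
  rewrite big_mkcond [leRHS]big_mkcond; apply: ler_sum => S _.
  case: ifP => [/andP[_ /eqP <-]|_]; last by case: ifP => // _; exact: final_prob_ge0.
  by rewrite inordK ?eqxx// ltnS -VN max_card.
apply: le_trans (final_prob_card lge0 kN (ltW t0)) _; rewrite ler_expR -mulrA.
set G := (1 - _) * _; have G01 : 0 <= 1 - expR (- rate (edge_rate beta N) k) <= 1.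
  by rewrite subr_ge0 expR_le1 oppr_le0 rate_ge0 //= gerBl expR_ge0.
rewrite VN in G *; case/andP: G01 => G0 G1.
have [_] := tk N%:R G k%:R (ler0n _ _) (mulr_ge0 G0 (ler0n _ _)) (ler_wpM2r (ler0n _ _) G1).
apply.
(* [s] is k / N lowered by J / N, so that [rate_ge] applies; for k < J it is 0. *)
pose s : R := if (J <= k)%N then (k - J)%:R / N%:R else 0.
have s0 : 0 <= s by rewrite /s; case: ifP => // _; rewrite divr_ge0.
have sN : k%:R - J%:R <= s * N%:R.
  rewrite /s; case: leqP => Jk; first by rewrite divfK ?gt_eqF// natrB.
  by rewrite mul0r subr_le0 ler_nat ltnW.
have sb : s <= b.
  rewrite /s; case: leqP => // Jk; rewrite ler_pdivrMr// (le_trans _ kb)// ler_nat.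
  exact: leq_subr.
have h1 : dpsum beta J s <= rate (edge_rate beta N) k.
  have Nk : (k <= N.-1.+1)%N by rewrite prednK// -ltnS.
  rewrite -{1}(prednK N0); apply: (rate_ge beta_ge0 s0 Nk).
  rewrite /s; case: leqP => Jk; [right|by left].
  apply: (@le_trans _ _ ((k - J)%:R + J%:R)); last by rewrite natrB// subrK.
  rewrite lerD2r -[leRHS]mulr1 -mulrA ler_wpM2l//.
  by rewrite ler_pdivrMl// mulr1 ler_nat leq_pred.
have h2 : s + eta <= 1 - expR (- rate (edge_rate beta N) k).
  apply: le_trans (hJ s _) _; first by rewrite s0.
  by rewrite lerD2l lerN2 ler_expR lerN2.
have h3 : (s + eta) * N%:R <= G by rewrite /G ler_wpM2r.
by move: h3; rewrite mulrDl; lra.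
Unshelve. all: by end_near. Qed.

(** A single level suffices: at m = floor(t (N - 1)) the rate is at most [p], so the mean fraction
    of levels up to [m] is at most 1 - exp(- p) < t. *)
Lemma final_prob_above (t p e : R) : 0 <= t < 1 -> p < - ln (1 - t) ->
  (forall J, dpsum beta J t <= p) -> 0 < e ->
  \forall N \near \oo, forall V : finType, #|V| = N ->
    \sum_(S : {set V} | t * N.-1%:R < #|S|%:R) final_prob (edge_rate beta N) S <= e.
Proof.
move=> /andP[t0 t1] pt dp e0.
have tp : 1 - expR (- p) < t.
  by rewrite ltrBlDr -ltrBlDl -[ltLHS]lnK ?posrE ?subr_gt0// ltr_expR; lra.
(* Half of the gap; the other half absorbs the rounding t N - m <= 2. *)
pose eta := (t - (1 - expR (- p))) / 2.
have eta0 : 0 < eta by rewrite divr_gt0// subr_gt0.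
have [th [kappa [th0 kappa0 tk]]] := chernoff_exponent eta0 ler01.
near=> N => V VN.
have N0 : (0 < N)%N by near: N; exact: nbhs_infty_gt.
have Nr : 0 < N%:R :> R by rewrite ltr0n.
have N2 : 2 <= eta * N%:R.
  by rewrite -ler_pdivrMl//; near: N; exact: nbhs_infty_ger.
have Ne : N.+1%:R * expR (- (kappa * N%:R)) <= e by near: N; exact: near_mulr_expR_le.
apply: le_trans Ne; apply: (@le_trans _ _ (expR (- (kappa * N%:R)))); last first.
  by rewrite ler_peMl ?expR_ge0// ler1n.
have lge0 := edge_rate_ge0 beta_ge0 N.
have NE : N%:R = N.-1%:R + 1 :> R by rewrite natr1 prednK.
pose m := Num.truncn (t * N.-1%:R).
have tN0 : 0 <= t * N.-1%:R by rewrite mulr_ge0.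
have /andP[m1 m2] := truncn_itv tN0; rewrite -/m in m1 m2.
have mN : (m <= N.-1)%N by rewrite -(ler_nat R) (le_trans m1)// ler_piMl// ltW.
have mV : (m <= #|V|)%N by rewrite VN (leq_trans mN)// leq_pred.
apply: (@le_trans _ _ (\sum_(S : {set V} | (m < #|S|)%N) final_prob (edge_rate beta N) S)).
  rewrite big_mkcond [leRHS]big_mkcond; apply: ler_sum => S _.
  case: ifP => [tS|_]; last by case: ifP => // _; exact: final_prob_ge0.
  by rewrite ifT// -(ltr_nat R) (le_lt_trans m1).
apply: le_trans (final_prob_large lge0 mV (ltW th0)) _; rewrite ler_expR -mulrA.
set G := (1 - _) * _; have G01 : 0 <= 1 - expR (- rate (edge_rate beta N) m) <= 1.
  by rewrite subr_ge0 expR_le1 oppr_le0 rate_ge0 //= gerBl expR_ge0.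
rewrite VN in G *; case/andP: G01 => G0 G1.
have [+ _] := tk N%:R G m%:R (ler0n _ _) (mulr_ge0 G0 (ler0n _ _)) (ler_wpM2r (ler0n _ _) G1).
apply.
have h1 : rate (edge_rate beta N) m <= p.
  rewrite -(prednK N0); apply: le_trans (dp m.+1); apply: rate_le => //.
  by rewrite t0 ltW.
have h2 : G <= (1 - expR (- p)) * N%:R.
  by rewrite /G ler_wpM2r// lerD2l lerN2 ler_expR lerN2.
have h3 : t * N%:R - 2 <= m%:R.
  by move: m2; rewrite NE -natr1 mulrDr mulr1; lra.
have h4 : eta * N%:R + eta * N%:R = t * N%:R - (1 - expR (- p)) * N%:R.
  by rewrite /eta; field.
lra.
Unshelve. all: by end_near. Qed.

End Concentration.

(** * Asymptotics of the compensator *)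

Section Compensator.
Variables (R : realType) (beta : nat -> R).
Hypothesis beta_ge0 : forall j, 0 <= beta j.
Hypothesis zstar_lt1 : zstar beta < 1.
Hypothesis zeta0 : zeta beta = set0.
Let z := zstar beta.
Let z0 : 0 <= z := zstar_ge0 zstar_lt1.
Let B := fine (power_sum beta z).
Let BE : power_sum beta z = B%:E.
Proof. by rewrite fineK // power_sum_zstar. Qed.

(* [s] approximates [z] strictly from below, where the drift is positive, except
   that [s = 0] when [z = 0]. *)
Lemma lower_parameters (e : R) : 0 < e -> exists s J v,
  [/\ 0 < v, 0 <= s < 1, s = 0 \/ s + v <= z, - ln (1 - s) <= dpsum beta J s &
    B - (1 - z) * ln (1 - z) - e <= psum beta J s - (1 - z - v) * ln (1 - s)].
Proof.
move=> e0; have [J1 hJ1] : exists J, B - e / 2 < psum beta J z.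
  apply: psum_power_sum_lt => //; rewrite BE lte_fin; lra.
have [z_gt0|z_le0] := ltP 0 z; last first.
  have zE : z = 0 by apply/eqP; rewrite eq_le z_le0.
  exists 0, J1, 1; split=> //; rewrite ?lexx ?ltr01//; first by left.
    by rewrite subr0 ln1 oppr0 dpsum_ge0.
  by move: hJ1; rewrite zE !subr0 ln1 !mulr0 !subr0; lra.
(* The choice s = z - v works for small v > 0 by continuity, as [F 0] exceeds the bound by the
   choice of [J1]. *)
pose F (v : R) := psum beta J1 (z - v) - (1 - z - v) * ln (1 - (z - v)).
have Fc : F v @[v --> (0 : R)^'+] --> F 0.
  apply: cvg_at_right_filter; apply: cvgB.
    apply: (@continuous_cvg _ _ _ _ _ _ (psum beta J1)).
      exact: continuous_psum.
    by apply: cvgB; [exact: cvg_cst|exact: cvg_id].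
  apply: cvgM; first by apply: cvgB; [exact: cvg_cst|exact: cvg_id].
  apply: (@cvg_comp _ _ _ (fun v : R => 1 - (z - v)) (@ln R) _ (nbhs (1 - (z - 0)))); last first.
    by apply: continuous_ln; rewrite subr0 subr_gt0.
  by do 2 (apply: cvgB; first exact: cvg_cst); exact: cvg_id.
have F0 : B - (1 - z) * ln (1 - z) - e < F 0 by rewrite /F !subr0; lra.
have /filter_ex[v [v0 vz vF]] : \forall v \near (0 : R)^'+,
    [/\ 0 < v, v < z & B - (1 - z) * ln (1 - z) - e < F v].
  near=> v; split; near: v; first exact: nbhs_right_gt.
    exact: nbhs_right_lt.
  exact: (cvgr_gt (F 0)).
have s0 : 0 <= z - v by rewrite subr_ge0 ltW.
have sz : z - v < z by rewrite gtrBl.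
have [J2 hJ2] := zstar_below beta_ge0 zstar_lt1 zeta0 s0 sz.
exists (z - v), (maxn J1 J2), v; split => //.
- by rewrite s0 (lt_trans sz).
- by right; rewrite subrK.
- by apply: (le_trans (ltW hJ2)); rewrite dpsum_monoJ// leq_maxr.
- apply: (le_trans (ltW vF)); rewrite /F lerB// psum_monoJ// leq_maxl.
  by [].
Unshelve. all: by end_near. Qed.

(** [u] will be z - b and will bound t - z. In the factor 2 u, one [u] accounts for the number of
    vertices outside, the other for the increase of beta from [z] to [t]. *)
Lemma upper_parameter (e w : R) : 0 < e -> 0 < w -> exists u,
  [/\ 0 < u, u < w, z + u < 1 &
    - ((1 - z + 2 * u) * ln (1 - z - u)) <= - ((1 - z) * ln (1 - z)) + e].
Proof.
move=> e0 w0; pose F (u : R) := - ((1 - z + 2 * u) * ln (1 - z - u)).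
have Fc : F u @[u --> (0 : R)^'+] --> F 0.
  apply: cvg_at_right_filter; apply: cvgN; apply: cvgM.
    apply: cvgD; first exact: cvg_cst.
    by apply: cvgM; [exact: cvg_cst|exact: cvg_id].
  apply: (@cvg_comp _ _ _ (fun u : R => 1 - z - u) (@ln R) _ (nbhs (1 - z - 0))); last first.
    by apply: continuous_ln; rewrite subr0 subr_gt0.
  by apply: cvgB; [exact: cvg_cst|exact: cvg_id].
have F0 : F 0 < - ((1 - z) * ln (1 - z)) + e by rewrite /F mulr0 addr0 subr0 ltrDl.
have /filter_ex[u [u0 uw uz uF]] : \forall u \near (0 : R)^'+,
    [/\ 0 < u, u < w, u < 1 - z & F u < - ((1 - z) * ln (1 - z)) + e].
  near=> u; split; near: u; first exact: nbhs_right_gt.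
  - exact: nbhs_right_lt.
  - by apply: nbhs_right_lt; rewrite subr_gt0.
  - exact: (cvgr_lt (F 0)).
by exists u; split=> //; [lra|exact: ltW].
Unshelve. all: by end_near. Qed.

Definition edges_constant : R := B - (1 - z) * ln (1 - z).

(** On this window of sizes, G_k consists of an inner part close to N beta(z) and of N - k vertices
    whose rate is close to - log(1 - z). *)
Lemma compensator_bounds (e : R) : 0 < e -> exists b t p,
  [/\ z - e < b < z, z <= t < z + e, 0 <= t < 1,
    p < - ln (1 - t) /\ (forall J, dpsum beta J t <= p) &
    \forall N \near \oo, forall V : finType, #|V| = N -> forall k : nat,
      (k <= N)%N -> b * N%:R < k%:R -> k%:R <= t * N.-1%:R ->
      (edges_constant - e) * N%:R <= compensator V (edge_rate beta N) k <=
      (edges_constant + e) * N%:R].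
Proof.
move=> e0; have [s [J [v [v0 /andP[s0 s1] sz sJ sc]]]] := lower_parameters e0.
(* When [s] is not 0, u < v / 2 gives k > (z - u) N >= s N + J for large [N], the reserve required
   by [inner_ge] and [rate_ge]. *)
have w0 : 0 < Num.min e (v / 2) by rewrite lt_min e0 divr_gt0.
have [u [u0 uw uz uc]] := upper_parameter e0 w0.
have [t [p [zt tu t1 pt dp]]] := zstar_above beta_ge0 zstar_lt1 u0.
have ue : u < e by move: uw; rewrite lt_min => /andP[].
have uv : u < v / 2 by move: uw; rewrite lt_min => /andP[].
have t0 : 0 <= t := le_trans z0 zt.
exists (z - u), t, p; split => //.
- by rewrite ltrD2l ltrN2 ue gtrBl.
- by rewrite zt (lt_trans tu)// ltrD2l.
- by rewrite t0.
near=> N => V VN k kN bk kt.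
have N0 : (0 < N)%N by near: N; exact: nbhs_infty_gt.
have Nr : 0 < N%:R :> R by rewrite ltr0n.
have JN : J%:R <= v / 2 * N%:R.
  by rewrite -ler_pdivrMl ?divr_gt0//; near: N; exact: nbhs_infty_ger.
have NE : N%:R = N.-1%:R + 1 :> R by rewrite natr1 prednK.
have sk : s = 0 \/ s * N%:R + J%:R <= k%:R.
  case: sz => [->|sz]; [by left|right].
  have : (s + v) * N%:R <= z * N%:R by rewrite ler_wpM2r.
  have : u * N%:R <= v / 2 * N%:R by rewrite ler_wpM2r// ltW.
  by move: bk; rewrite mulrBl mulrDl; lra.
have sk' : s = 0 \/ s * N.-1%:R + J%:R <= k%:R.
  case: sk => [->|sk]; [by left|right].
  by rewrite (le_trans _ sk)// lerD2r ler_wpM2l// ler_nat leq_pred.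
have ktN : k%:R <= t * N%:R by rewrite (le_trans kt)// ler_wpM2l// ler_nat leq_pred.
have t01 : 0 <= t <= 1 by rewrite t0 ltW.
have kN' : (k <= N.-1.+1)%N by rewrite prednK.
have r_le : rate (edge_rate beta N) k <= p.
  by rewrite -(prednK N0); apply: le_trans (dp k.+1); exact: rate_le.
have r_ge : - ln (1 - s) <= rate (edge_rate beta N) k.
  by rewrite -{1}(prednK N0); apply: (le_trans sJ); exact: rate_ge.
have l0 : 0 <= - ln (1 - s) by rewrite oppr_ge0 ln_le0// gerBl.
have p0 : 0 <= p by rewrite (le_trans _ (dp 0%N))// dpsum_ge0.
rewrite /compensator VN natrB//; apply/andP; split.
  have h1 := inner_ge beta_ge0 s0 kN sk.
  have h2 : (1 - z - v) * N%:R * - ln (1 - s) <=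
      (N%:R - k%:R) * rate (edge_rate beta N) k.
    apply: (@le_trans _ _ ((N%:R - k%:R) * - ln (1 - s))).
      rewrite ler_wpM2r//; move: ktN tu; rewrite -(ltr_pM2r Nr) mulrDl.
      have : u * N%:R <= v / 2 * N%:R by rewrite ler_wpM2r// ltW.
      have : 0 <= v * N%:R by rewrite mulr_ge0// ltW.
      by rewrite -/z; lra.
    by rewrite ler_wpM2l// subr_ge0 ler_nat.
  have h3 : (edges_constant - e) * N%:R <=
      (psum beta J s - (1 - z - v) * ln (1 - s)) * N%:R by rewrite ler_wpM2r.
  by move: h1 h2 h3; lra.
have h1 := inner_le beta_ge0 t01 ktN.
have h2 : psum beta k.+1 t <= B + (t - z) * p.
  apply: (le_trans (psum_increment beta_ge0 k.+1 z0 zt)); apply: lerD.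
    by rewrite -lee_fin -BE psum_le_power_sum.
  by rewrite ler_wpM2l// subr_ge0.
have h3 : (N%:R - k%:R) * rate (edge_rate beta N) k <= (1 - z + u) * N%:R * p.
  apply: (@le_trans _ _ ((N%:R - k%:R) * p)).
    by rewrite ler_wpM2l// subr_ge0 ler_nat.
  by rewrite ler_wpM2r//; move: bk; rewrite -/z; lra.
have h4 : p <= - ln (1 - z - u).
  by rewrite (le_trans (ltW pt))// lerN2 ler_ln ?posrE; move: tu; rewrite -/z; lra.
have h5 : (1 - z + 2 * u) * p <= - ((1 - z + 2 * u) * ln (1 - z - u)).
  by rewrite -mulrN ler_wpM2l// addr_ge0 ?subr_ge0 ?ltW// mulr_gt0.
have h6 : (t - z) * p <= u * p by rewrite ler_wpM2r//; move: tu; rewrite -/z; lra.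
have h7 : N%:R * psum beta k.+1 t <= N%:R * (B + u * p).
  by rewrite ler_wpM2l// (le_trans h2)// lerD2l.
have h8 : (B + (1 - z + 2 * u) * p) * N%:R <= (edges_constant + e) * N%:R.
  by rewrite ler_wpM2r// /edges_constant; move: (le_trans h5 uc); lra.
by move: h1 h3 h7 h8; lra.
Unshelve. all: by end_near. Qed.

End Compensator.

(** * Deviation bounds for truncated multiplicities *)

Section Truncation.
Variables (R : realType) (V : finType) (l : nat -> R) (K : nat).
Hypothesis l_ge0 : forall j, 0 <= l j.

Let w (A : {set V}) (n : 'I_K.+1) := poisson_weight (l #|A|) n.
Let w_ge0 A n : 0 <= w A n. Proof. exact: poisson_weight_ge0. Qed.

Lemma wprob_or (E1 E2 : {ffun {set V} -> 'I_K.+1} -> bool) :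
  wprob w (fun f => E1 f || E2 f) <= wprob w E1 + wprob w E2.
Proof.
rewrite /wprob big_mkcond [X in _ <= X + _]big_mkcond [X in _ <= _ + X]big_mkcond -big_split.
apply: ler_sum => f _ /=; have W0 : 0 <= \prod_A w A (f A) by apply: prodr_ge0.
by case: (E1 f); case: (E2 f); rewrite /= ?addr0 ?add0r// lerDl.
Qed.

Lemma total_edgesE (h : hypergraph V) :
  total_edges (identifiable_hypergraph h) =
  (\sum_(A : {set V} | A \subset identifiable_set h) h A)%N.
Proof. by rewrite /total_edges [RHS]big_mkcond. Qed.

(** Split according to the identifiable set and apply [tilting] to each value. *)
Lemma truncated_edges_le (Q : pred {set V}) (t a : R) :
  wprob w (fun f => let h := (fun A : {set V} => f A : nat) in
    Q (identifiable_set h) &&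
    (0 <= t * ((total_edges (identifiable_hypergraph h))%:R - a))) <=
  \sum_(S | Q S) expR (- (t * a) + (expR t - 1) * compensator V l #|S|) *
    final_prob (fun j => expR t * l j) S.
Proof.
rewrite (@sum_wprob R _ _ {set V} w _ (fun S f =>
  (identifiable_set (fun A : {set V} => f A : nat) == S) &&
  (0 <= t * ((\sum_(A : {set V} | A \subset S) (f A : nat))%:R - a))) Q).
- by apply: ler_sum => S _; exact: tilting.
- move=> f /=; rewrite total_edgesE; apply/idP/existsP => [/andP[Qf tf]|[S /and3P[QS /eqP -> tS]]].
    by exists (identifiable_set (fun A : {set V} => f A : nat)); rewrite Qf eqxx.
  by rewrite QS.
- by move=> f S S' /andP[/eqP<- _] /andP[/eqP].
Qed.

(** The case t = 0 of [truncated_edges_le], where the tilt is trivial. *)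
Lemma truncated_size_le (Q : pred {set V}) :
  wprob w (fun f => Q (identifiable_set (fun A : {set V} => f A : nat))) <=
  \sum_(S | Q S) final_prob l S.
Proof.
apply: le_trans (_ : _ <= _) (le_trans (@truncated_edges_le Q 0 0) _).
  by apply: wprob_le => // f Qf /=; rewrite Qf mul0r lexx.
apply: ler_sum => S _; rewrite mul0r oppr0 expR0 subrr mul0r addr0 expR0 mul1r.
rewrite le_eqVlt; apply/orP; left; apply/eqP; congr final_prob; apply/funext => j.
by rewrite mul1r.
Qed.

(** The exponential factor is bounded uniformly over [Q], and the tilted final probabilities sum to
    1. *)
Lemma truncated_edges_exp (Q : pred {set V}) (t a x : R) :
  (forall S, Q S -> - (t * a) + (expR t - 1) * compensator V l #|S| <= x) ->
  wprob w (fun f => let h := (fun A : {set V} => f A : nat) in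
    Q (identifiable_set h) &&
    (0 <= t * ((total_edges (identifiable_hypergraph h))%:R - a))) <= expR x.
Proof.
move=> Qx; apply: le_trans (truncated_edges_le Q t a) _.
have l'0 j : 0 <= expR t * l j by rewrite mulr_ge0 ?expR_ge0.
rewrite -[leRHS]mulr1 -[X in _ <= _ * X](sum_final_prob V (fun j => expR t * l j)) mulr_sumr.
rewrite big_mkcond; apply: ler_sum => S _; case: ifPn => [QS|_].
  by apply: ler_wpM2r; [exact: final_prob_ge0|rewrite ler_expR; exact: Qx].
by apply: mulr_ge0; [exact: expR_ge0|exact: final_prob_ge0].
Qed.

Lemma compensator_ge0 k : 0 <= compensator V l k.
Proof.
rewrite addr_ge0 ?mulr_ge0 ?rate_ge0// sumr_ge0// => i _; rewrite mulr_ge0//.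
Qed.

End Truncation.

(** * Convergence in probability *)

Lemma cvg_in_prob_near (R : realType) (d : nat -> measure_display)
    (T : forall N, measurableType (d N)) (P : forall N, probability (T N) R)
    (X : forall N, T N -> R) (c : R) :
  (forall e e', 0 < e -> 0 < e' ->
    \forall N \near \oo, (P N [set w | (e < `|X N w - c|)%R] <= e'%:E)%E) ->
  cvg_in_prob P X c.
Proof.
move=> H e e0; apply/fine_cvgP; split.
  near=> N; rewrite ge0_fin_numE//; apply: (@le_lt_trans _ _ 1%:E); last exact: ltry.
  by near: N; exact: H.
apply/cvgr0Pnorm_le => e' e'0; near=> N.
have h : (P N [set w | (e < `|X N w - c|)%R] <= e'%:E)%E by near: N; exact: H.
rewrite /= ger0_norm ?fine_ge0// -lee_fin fineK// ge0_fin_numE//.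
exact: le_lt_trans h (ltry _).
Unshelve. all: by end_near. Qed.

Section Limits.
Variables (R : realType) (beta : nat -> R).
Hypothesis beta_ge0 : forall j, 0 <= beta j.
Hypothesis zstar_lt1 : zstar beta < 1.
Hypothesis zeta0 : zeta beta = set0.
Let z := zstar beta.

Definition truncated_law (V : finType) K (A : {set V}) (n : 'I_K.+1) : R :=
  poisson_weight (edge_rate beta #|V| #|A|) n.

(** Sizes off the window on which [compensator_bounds] controls G_k. *)
Definition outside (b t : R) (V : finType) (S : {set V}) : bool :=
  (#|S|%:R <= b * #|V|%:R) || (t * #|V|.-1%:R < #|S|%:R).

Lemma truncated_outside_le (b t p e : R) : b < z -> 0 <= t < 1 -> p < - ln (1 - t) ->
  (forall J, dpsum beta J t <= p) -> 0 < e ->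
  \forall N \near \oo, forall V : finType, #|V| = N -> forall K,
    wprob (@truncated_law V K)
      (fun f => outside b t (identifiable_set (fun A : {set V} => f A : nat))) <= e.
Proof.
move=> bz t01 pt dp e0; have e2 : 0 < e / 2 by rewrite divr_gt0.
have B := final_prob_below beta_ge0 zstar_lt1 zeta0 bz e2.
have A := final_prob_above beta_ge0 t01 pt dp e2.
near=> N => V VN K.
have BN : \sum_(S : {set V} | #|S|%:R <= b * N%:R) final_prob (edge_rate beta N) S <= e / 2.
  by move: V VN; near: N; exact: B.
have AN : \sum_(S : {set V} | t * N.-1%:R < #|S|%:R) final_prob (edge_rate beta N) S <= e / 2.
  by move: V VN {BN}; near: N; exact: A.
have lge0 := edge_rate_ge0 beta_ge0 N.
rewrite -VN in lge0 AN BN; apply: le_trans (truncated_size_le K lge0 _) _.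
rewrite [leRHS]splitr; apply: le_trans (lerD BN AN).
rewrite big_mkcond [X in _ <= X + _]big_mkcond [X in _ <= _ + X]big_mkcond -big_split.
apply: ler_sum => S _ /=; have F0 := final_prob_ge0 lge0 S; rewrite /outside.
by case: (#|S|%:R <= b * #|V|%:R); case: (t * #|V|.-1%:R < #|S|%:R); rewrite /= ?addr0 ?add0r// lerDl.
Unshelve. all: by end_near. Qed.

Lemma truncated_size (e e' : R) : 0 < e -> 0 < e' ->
  \forall N \near \oo, forall V : finType, #|V| = N -> forall K,
    wprob (@truncated_law V K) (fun f =>
      e < `|#|identifiable_set (fun A : {set V} => f A : nat)|%:R / N%:R - z|) <= e'.
Proof.
move=> e0 e'0; have [b [t [p [/andP[b1 b2] /andP[zt tz] t01 [pt dp] _]]]] :=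
  compensator_bounds beta_ge0 zstar_lt1 zeta0 e0.
have O := truncated_outside_le b2 t01 pt dp e'0.
near=> N => V VN K.
have N0 : (0 < N)%N by near: N; exact: nbhs_infty_gt.
have Nr : 0 < N%:R :> R by rewrite ltr0n.
have ON : wprob (@truncated_law V K)
    (fun f => outside b t (identifiable_set (fun A : {set V} => f A : nat))) <= e'.
  by move: V VN K; near: N; exact: O.
apply: le_trans ON; apply: wprob_le => [A n|f].
  exact/poisson_weight_ge0/edge_rate_ge0.
set k := #|_|; apply: contraTT; rewrite /outside negb_or -!ltNge -leNgt -/k VN.
move=> /andP[bk kt]; rewrite -leNgt ler_norml.
have h1 : b < k%:R / N%:R by rewrite ltr_pdivlMr.
have h2 : k%:R / N%:R <= t.
  rewrite ler_pdivrMr//; apply: le_trans kt _.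
  by rewrite ler_wpM2l ?ler_nat ?leq_pred//; case/andP: t01.
by apply/andP; split; move: b1 tz; rewrite -/z; lra.
Unshelve. all: by end_near. Qed.

(** Three errors of e' / 3: a size off the window, too many edges, too few. On the window G_k / N is
    within e / 2 of the limit, so a deviation by [e] leaves e / 2 for [chernoff_exponent]. *)
Lemma truncated_edges (e e' : R) : 0 < e -> 0 < e' ->
  \forall N \near \oo, forall V : finType, #|V| = N -> forall K,
    wprob (@truncated_law V K) (fun f =>
      e < `|(total_edges (identifiable_hypergraph (fun A : {set V} => f A : nat)))%:R / N%:R
            - edges_constant beta|) <= e'.
Proof.
move=> e0 e'0; have e20 : 0 < e / 2 by rewrite divr_gt0.
have e'30 : 0 < e' / 3 by rewrite divr_gt0.
have [b [t [p [/andP[b1 b2] /andP[zt tz] t01 [pt dp] cb]]]] :=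
  compensator_bounds beta_ge0 zstar_lt1 zeta0 e20.
have O := truncated_outside_le b2 t01 pt dp e'30.
set c := edges_constant beta.
have C0 : 0 <= `|c| + e by rewrite addr_ge0// ltW.
have [th [kappa [th0 kappa0 tk]]] := chernoff_exponent e20 C0.
near=> N => V VN K.
have N0 : (0 < N)%N by near: N; exact: nbhs_infty_gt.
have Nr : 0 < N%:R :> R by rewrite ltr0n.
have ON : wprob (@truncated_law V K)
    (fun f => outside b t (identifiable_set (fun A : {set V} => f A : nat))) <= e' / 3.
  by move: V VN K; near: N; exact: O.
have cN : forall k : nat, (k <= N)%N -> b * N%:R < k%:R -> k%:R <= t * N.-1%:R ->
    (c - e / 2) * N%:R <= compensator V (edge_rate beta N) k <= (c + e / 2) * N%:R.
  by move: V VN {K ON}; near: N; exact: cb.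
have Ne : N.+1%:R * expR (- (kappa * N%:R)) <= e' / 3 by near: N; exact: near_mulr_expR_le.
have {}Ne : expR (- (kappa * N%:R)) <= e' / 3.
  by apply: le_trans Ne; rewrite ler_peMl ?expR_ge0// ler1n.
have w0 (A : {set V}) (n : 'I_K.+1) : 0 <= truncated_law A n.
  exact/poisson_weight_ge0/edge_rate_ge0.
have lge0 : forall j, 0 <= edge_rate beta #|V| j by exact: edge_rate_ge0.
have inside (S : {set V}) : ~~ outside b t S ->
    [/\ 0 <= compensator V (edge_rate beta #|V|) #|S|,
      compensator V (edge_rate beta #|V|) #|S| <= (`|c| + e) * N%:R,
      (c - e / 2) * N%:R <= compensator V (edge_rate beta #|V|) #|S| &
      compensator V (edge_rate beta #|V|) #|S| <= (c + e / 2) * N%:R].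
  rewrite /outside negb_or -ltNge -leNgt VN => /andP[bk kt].
  have SN : (#|S| <= N)%N by rewrite -VN max_card.
  have /andP[h1 h2] := cN _ SN bk kt; split => //.
    by rewrite -VN; exact: compensator_ge0.
  by apply: le_trans h2 _; rewrite ler_wpM2r// lerD ?ler_norm//; lra.
pose tot (f : {ffun {set V} -> 'I_K.+1}) : R :=
  (total_edges (identifiable_hypergraph (fun A : {set V} => f A : nat)))%:R.
have hi : wprob (@truncated_law V K) (fun f =>
    ~~ outside b t (identifiable_set (fun A : {set V} => f A : nat)) &&
    (0 <= th * (tot f - (c + e) * N%:R))) <= e' / 3.
  apply: le_trans Ne; apply: (@truncated_edges_exp _ _ _ K lge0 (fun S => ~~ outside b t S)).
  move=> S /inside[G0 GC _ G1].
  have [+ _] := tk _ _ ((c + e) * N%:R) (ler0n _ N) G0 GC.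
  by apply; move: G1; rewrite !mulrDl; lra.
have lo : wprob (@truncated_law V K) (fun f =>
    ~~ outside b t (identifiable_set (fun A : {set V} => f A : nat)) &&
    (0 <= - th * (tot f - (c - e) * N%:R))) <= e' / 3.
  apply: le_trans Ne; apply: (@truncated_edges_exp _ _ _ K lge0 (fun S => ~~ outside b t S)).
  move=> S /inside[G0 GC G1 _]; rewrite mulNr opprK.
  have [_] := tk _ _ ((c - e) * N%:R) (ler0n _ N) G0 GC.
  by apply; move: G1; rewrite !mulrBl; lra.
have -> : e' = e' / 3 + (e' / 3 + e' / 3) by field.
apply: le_trans (lerD ON (lerD hi lo)).
apply: le_trans (lerD (lexx _) (wprob_or lge0 _ _)).
apply: le_trans (wprob_or lge0 _ _); apply: wprob_le => // f ef.
case: (outside _ _ _) => //=; rewrite -/(tot f) in ef.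
have [Tc|Tc] := leP 0 (tot f / N%:R - c).
  rewrite ger0_norm// ltrBrDl ltr_pdivlMr// in ef.
  by rewrite mulr_ge0 ?(ltW th0)// subr_ge0 ltW.
rewrite ltr0_norm// opprB ltrBrDl -ltrBrDr ltr_pdivrMr// in ef.
by rewrite orbC mulNr -mulrN opprB mulr_ge0 ?(ltW th0)// subr_ge0 ltW.
Unshelve. all: by end_near. Qed.

End Limits.

(* [power_sum beta (zstar beta)] is finite because [zstar beta < 1] provides
   some [t >= zstar beta], [t < 1], at which [power_sum' beta t] is finite. *)
Theorem theorem2p1 (R : realType) (beta : nat -> R)
  (beta_ge0 : forall j, 0 <= beta j)
  (zstar_lt1 : zstar beta < 1)
  (zeta0 : zeta beta = set0)
  (V : nat -> finType) (cardV : forall N, #|V N| = N)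
  (d : nat -> measure_display) (T : forall N, measurableType (d N))
  (P : forall N, probability (T N) R)
  (L : forall N, {set V N} -> {RV (P N) >-> nat})
  (L_poisson : forall N, poisson_hypergraph beta (L N)) :
  cvg_in_prob P
    (fun N w => #|identifiable_set (hypergraph_at (L N) w)|%:R / N%:R)
    (zstar beta) /\
  cvg_in_prob P
    (fun N w =>
       (total_edges (identifiable_hypergraph (hypergraph_at (L N) w)))%:R / N%:R)
    (fine (power_sum beta (zstar beta))
       - (1 - zstar beta) * ln (1 - zstar beta)).
Proof.
(* Bounds for truncated weights that are uniform in [V] and [K] pass to the given random
   hypergraphs. *)
have main Q (c : nat -> R) : (\forall N \near \oo, forall V : finType, #|V| = N -> forall K,
    wprob (@truncated_law R beta V K) (fun f => Q N V (fun A : {set V} => f A : nat)) <= c N) ->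
    \forall N \near \oo, (P N [set w | Q N (V N) (hypergraph_at (L N) w)] <= (c N)%:E)%E.
  move=> H; near=> N; apply: (poisson_hypergraph_le beta_ge0 (L_poisson N)) => K.
  have : forall V : finType, #|V| = N -> forall K,
    wprob (@truncated_law R beta V K) (fun f => Q N V (fun A : {set V} => f A : nat)) <= c N.
    by near: N; exact: H.
  by apply; exact: cardV.
split; apply: cvg_in_prob_near => e e' e0 e'0.
  apply: (main (fun N V h => e < `|#|identifiable_set h|%:R / N%:R - zstar beta|) (fun=> e')).
  exact: truncated_size.
apply: (main (fun N V h => e < `|(total_edges (identifiable_hypergraph h))%:R / N%:R
    - edges_constant beta|) (fun=> e')).
exact: truncated_edges.
Unshelve. all: by end_near. Qed.
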